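(* For all regular curves $\gamma\in W^{\frac32,2}(\mathbb R/\mathbb Z,\mathbb R^3)$ we have $E^1(\gamma)\ge 2\pi^2$.
   Context: A (closed) curve $\gamma:\mathbb R/\mathbb Z\to\mathbb R^3$ is called regular if $|\gamma'|\ge c$ almost everywhere for some constant $c>0$. With the unit tangent $\tau=\frac{\gamma'}{|\gamma'|}$, the energy $E^1$ is $$E^1(\gamma)=\iint_{(\mathbb R/\mathbb Z)^2}\frac{|\tau(x)-\tau(y)|^2}{2|\gamma(x)-\gamma(y)|^2}\,|\gamma'(x)||\gamma'(y)|\,dx\,dy\in[0,\infty].$$ Fractional Sobolev space: $W^{\frac32,2}(\mathbb R/\mathbb Z,\mathbb R^3)$ consists of all $f\in W^{1,2}(\mathbb R/\mathbb Z,\mathbb R^3)$ for which $$\int_{\mathbb R/\mathbb Z}\int_{\mathbb R/\mathbb Z}\frac{|f'(x)-f'(y)|^2}{|x-y|^2}\,dx\,dy<\infty,$$ where $|x-y|$ is the distance on $\mathbb R/\mathbb Z$. *)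

(* Defs.v *)
From HB Require Import structures.
From mathcomp Require Import all_boot all_order all_algebra.
From mathcomp Require Import all_classical all_reals all_analysis.

Set Implicit Arguments.
Unset Strict Implicit.
Unset Printing Implicit Defensive.

Import Order.TTheory GRing.Theory Num.Theory.
Import numFieldNormedType.Exports.

Local Open Scope classical_set_scope.
Local Open Scope ring_scope.

(* A function on the circle R/Z is a function on R such that [periodic f 1];
   integrals over R/Z are integrals over the fundamental domain [0, 1]. *)

(* Euclidean norm; the library norm on row vectors is the sup norm. *)
Definition enorm (R : realType) (n : nat) (v : 'rV[R]_n) : R :=
  Num.sqrt (\sum_(i < n) v 0 i ^+ 2).

(* Quotient distance on R/Z: the distance from x - y to the nearest integer. *)
Definition circle_dist (R : realType) (x y : R) : R :=
  let t := x - y - (Num.floor (x - y))%:~R in Num.min t (1 - t).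

Definition smooth (R : realType) (phi : R -> R) : Prop :=
  forall (n : nat) (x : R), derivable (derive1n n phi) x 1.

Definition circle_L1 (R : realType) (n : nat) (f : R -> 'rV[R]_n) : Prop :=
  forall i : 'I_n,
    (@lebesgue_measure R).-integrable `[0%R, 1%R] (fun x : R => (f x 0 i)%:E).

Definition circle_L2 (R : realType) (n : nat) (f : R -> 'rV[R]_n) : Prop :=
  forall i : 'I_n,
    measurable_fun (`[0, 1] : set R) (fun x : R => f x 0 i) /\
    (@lebesgue_measure R).-integrable `[0%R, 1%R] (fun x : R => (f x 0 i ^+ 2)%:E).

(* The test functions are the smooth functions on R/Z, so there is no boundary
   term in the integration by parts. *)
Definition is_weak_deriv (R : realType) (n : nat) (f g : R -> 'rV[R]_n) : Prop :=
  [/\ periodic g 1, circle_L1 f, circle_L1 g &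
    forall (phi : R -> R) (i : 'I_n), periodic phi 1 -> smooth phi ->
      (\int[lebesgue_measure]_(x in `[0%R, 1%R]) (f x 0 i * derive1 phi x)
       = - \int[lebesgue_measure]_(x in `[0%R, 1%R]) (g x 0 i * phi x))%R].

(* A representative of the weak derivative, which is unique up to a null set;
   the junk value 0 is used when there is none. *)
Definition weak_deriv (R : realType) (n : nat) (f : R -> 'rV[R]_n) :
  R -> 'rV[R]_n := xget (fun=> 0) [set g | is_weak_deriv f g].

Definition sobolev_1_2 (R : realType) (n : nat) (f : R -> 'rV[R]_n) : Prop :=
  [/\ circle_L2 f, exists g, is_weak_deriv f g & circle_L2 (weak_deriv f)].

(* On the null set x = y in R/Z the integrand takes the junk value 0 / 0 = 0. *)
Definition sobolev_3half_2 (R : realType) (n : nat) (f : R -> 'rV[R]_n) : Prop :=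
  sobolev_1_2 f /\
  (\int[lebesgue_measure]_(x in `[0%R, 1%R])
   \int[lebesgue_measure]_(y in `[0%R, 1%R])
     (enorm (weak_deriv f x - weak_deriv f y) ^+ 2
      / circle_dist x y ^+ 2)%:E < +oo)%E.

Definition regular_curve (R : realType) (n : nat) (gamma : R -> 'rV[R]_n) : Prop :=
  exists2 c : R, 0 < c &
    {ae lebesgue_measure, forall x : R, c <= enorm (weak_deriv gamma x)}.

Definition unit_tangent (R : realType) (n : nat) (gamma : R -> 'rV[R]_n) (x : R) :
  'rV[R]_n := (enorm (weak_deriv gamma x))^-1 *: weak_deriv gamma x.

(* Division by 0 yields 0. For a regular curve this only matters on a null set:
   gamma' = 0 almost everywhere on each level set of gamma, so the pairs with
   gamma x = gamma y form a null set. *)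
Definition energy1 (R : realType) (n : nat) (gamma : R -> 'rV[R]_n) : \bar R :=
  (\int[lebesgue_measure \x lebesgue_measure]_(z in `[0%R, 1%R] `*` `[0%R, 1%R])
    (enorm (unit_tangent gamma z.1 - unit_tangent gamma z.2) ^+ 2
     / (2 * enorm (gamma z.1 - gamma z.2) ^+ 2)
     * enorm (weak_deriv gamma z.1) * enorm (weak_deriv gamma z.2))%:E)%E.

(* Main.v *)
Require Import Defs.
From HB Require Import structures.
From mathcomp Require Import all_boot all_order all_algebra.
From mathcomp Require Import all_classical all_reals all_analysis.
From mathcomp Require Import measurable_realfun.
From mathcomp Require Import ring lra.

Set Implicit Arguments.
Unset Strict Implicit.
Unset Printing Implicit Defensive.

Import Order.TTheory GRing.Theory Num.Theory.
Import numFieldNormedType.Exports.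

Local Open Scope classical_set_scope.
Local Open Scope ring_scope.

(* Let Gam be a parametrization of the curve with constant speed L and period 1,
   and T = Gam' its tangent. For each shift h, the chord F(x) = Gam(x + h) - Gam(x)
   is a closed curve whose integral over a period vanishes, so its direction F/|F|
   is a closed spherical curve that is contained in no open hemisphere and hence
   has length at least 2 pi (Fenchel). The speed of F/|F| is at most |F'|/|F|, so by
   Cauchy-Schwarz the integral of |T(x + h) - T(x)|^2 / |Gam(x + h) - Gam(x)|^2 over
   x is at least (2 pi)^2. Integrating over h gives 2 E^1 >= 4 pi^2.

   A Sobolev curve agrees almost everywhere with a primitive of its weak derivative
   (du Bois-Reymond, with trigonometric polynomials as test functions), which has an
   arclength reparametrization since the speed is bounded below. *)

(** * Euclidean norm and angles *)

(** The direction of a chord [F] only makes sense where [F] is nonzero, and the chord for a given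
    shift may vanish somewhere. Two facts remove this obstacle. Since [|F'| / |F|] bounds the
    derivative of [log |F|], its integrability forces [F] to vanish either nowhere or everywhere;
    and where it is not even square integrable, the bound for that shift is trivial. Shifts whose
    chord vanishes identically are isolated because the curve is not constant, so they form a
    countable null set.

    No length of spherical curves is defined. Its role is played by [V], the primitive of
    [|F'| / |F|]: the angle between two directions is at most the increment of [V], which is shown
    on short intervals up to a quadratic error and then exactly by subdivision.

    Constant speed [L] makes [F'] a difference of two tangents of the same length [L], so the
    squared relative speed of the chord is twice the energy integrand in the new parameter. This is
    how (2 pi)^2 becomes 2 pi^2. *)

Section euclidean.
Variables (R : realType) (n : nat).
Implicit Types (u v w : 'rV[R]_n) (a b : R).

Definition dotp u v : R := \sum_i u 0 i * v 0 i.

Lemma dotpC u v : dotp u v = dotp v u.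
Proof. by apply: eq_bigr => i _; rewrite mulrC. Qed.

Lemma dotpDl u v w : dotp (u + v) w = dotp u w + dotp v w.
Proof. by rewrite -big_split; apply: eq_bigr => i _; rewrite mxE mulrDl. Qed.

Lemma dotpZl a u v : dotp (a *: u) v = a * dotp u v.
Proof. by rewrite /dotp mulr_sumr; apply: eq_bigr => i _; rewrite mxE mulrA. Qed.

Lemma dotpBl u v w : dotp (u - v) w = dotp u w - dotp v w.
Proof. by rewrite dotpDl -scaleN1r dotpZl mulN1r. Qed.

Lemma dotpDr u v w : dotp u (v + w) = dotp u v + dotp u w.
Proof. by rewrite dotpC dotpDl !(dotpC u). Qed.

Lemma dotpBr u v w : dotp u (v - w) = dotp u v - dotp u w.
Proof. by rewrite dotpC dotpBl !(dotpC u). Qed.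

Lemma dotpZr a u v : dotp u (a *: v) = a * dotp u v.
Proof. by rewrite dotpC dotpZl dotpC. Qed.

Lemma dotp_ge0 u : 0 <= dotp u u.
Proof. by apply: sumr_ge0 => i _; rewrite -expr2 sqr_ge0. Qed.

Lemma enorm_sqr u : enorm u ^+ 2 = dotp u u.
Proof.
by rewrite /enorm sqr_sqrtr; [|apply: sumr_ge0 => i _; exact: sqr_ge0].
Qed.

Lemma enorm_ge0 u : 0 <= enorm u.
Proof. exact: sqrtr_ge0. Qed.

Lemma enorm0 : enorm (0 : 'rV[R]_n) = 0.
Proof.
by rewrite /enorm big1 ?sqrtr0// => i _; rewrite mxE expr0n.
Qed.

Lemma enorm_eq0 u : (enorm u == 0) = (u == 0).
Proof.
apply/eqP/eqP => [u0|->]; last exact: enorm0.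
have /eqP : dotp u u = 0 by rewrite -enorm_sqr u0 expr0n.
rewrite psumr_eq0 => [/allP u0'|i _]; last by rewrite -expr2 sqr_ge0.
apply/rowP => i; rewrite mxE.
by have := u0' i (mem_index_enum _); rewrite -expr2 sqrf_eq0 => /eqP.
Qed.

Lemma enorm_gt0 u : (0 < enorm u) = (u != 0).
Proof. by rewrite lt_def enorm_ge0 andbT enorm_eq0. Qed.

Lemma enormZ a u : enorm (a *: u) = `|a| * enorm u.
Proof.
apply/eqP; rewrite -(eqrXn2 (ltn0Sn 1)) ?mulr_ge0 ?enorm_ge0//.
by rewrite exprMn real_normK ?num_real// !enorm_sqr dotpZl dotpZr mulrA.
Qed.

Lemma dotp_sqr_le u v : dotp u v ^+ 2 <= dotp u u * dotp v v.
Proof.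
have [v0|v0] := eqVneq v 0.
  rewrite v0; have -> : dotp u 0 = 0 by apply: big1 => i _; rewrite mxE mulr0.
  by rewrite expr0n mulr_ge0// dotp_ge0.
have vv : 0 < dotp v v by rewrite -enorm_sqr exprn_gt0// enorm_gt0.
have := dotp_ge0 (dotp v v *: u - dotp u v *: v).
rewrite !(dotpBl, dotpBr, dotpZl, dotpZr) (dotpC v u).
move=> h; have : 0 <= dotp v v * (dotp u u * dotp v v - dotp u v ^+ 2).
  by apply: le_trans h _; rewrite le_eqVlt; apply/orP; left; apply/eqP; ring.
by rewrite pmulr_rge0// subr_ge0.
Qed.

Lemma dotp_le u v : dotp u v <= enorm u * enorm v.
Proof.
apply: le_trans (ler_norm _) _.
rewrite -ler_sqr ?nnegrE ?mulr_ge0 ?enorm_ge0//.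
by rewrite exprMn !enorm_sqr real_normK ?num_real// dotp_sqr_le.
Qed.

Lemma enormD u v : enorm (u + v) <= enorm u + enorm v.
Proof.
rewrite -ler_sqr ?nnegrE ?addr_ge0 ?enorm_ge0//.
rewrite sqrrD !enorm_sqr !(dotpDl, dotpDr) (dotpC v u).
by have := dotp_le u v; lra.
Qed.

Lemma enormN u : enorm (- u) = enorm u.
Proof. by rewrite -scaleN1r enormZ normrN1 mul1r. Qed.

Lemma enorm_distC u v : enorm (u - v) = enorm (v - u).
Proof. by rewrite -enormN opprB. Qed.

Lemma enormB u v : enorm (u - v) <= enorm u + enorm v.
Proof. by rewrite -(enormN v) enormD. Qed.

Lemma lerB_enorm u v : enorm u - enorm v <= enorm (u - v).
Proof. by rewrite lerBlDr -{1}(subrK v u) enormD. Qed.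

Lemma le_coord_enorm u i : `|u 0 i| <= enorm u.
Proof.
rewrite -ler_sqr ?nnegrE ?enorm_ge0//.
rewrite real_normK ?num_real// enorm_sqr /dotp (bigD1 i)//= -expr2 lerDl.
by apply: sumr_ge0 => j _; rewrite -expr2 sqr_ge0.
Qed.

Lemma enorm_sum_le u : enorm u <= \sum_i `|u 0 i|.
Proof.
rewrite -ler_sqr ?nnegrE ?enorm_ge0 ?sumr_ge0//.
rewrite enorm_sqr expr2 big_distrl /=; apply: ler_sum => i _.
rewrite -expr2 -(real_normK (num_real _)) expr2 ler_wpM2l//.
by rewrite (bigD1 i)//= lerDl sumr_ge0.
Qed.

Definition normalize u := (enorm u)^-1 *: u.

Lemma enorm_normalize u : u != 0 -> enorm (normalize u) = 1.
Proof.
rewrite -enorm_gt0 => u0.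
by rewrite enormZ gtr0_norm ?invr_gt0// mulVf// gt_eqF.
Qed.

Lemma enorm_normalize_le1 u : enorm (normalize u) <= 1.
Proof.
have [->|u0] := eqVneq u 0; last by rewrite enorm_normalize.
by rewrite /normalize scaler0 enorm0.
Qed.

(** Multiplied by |u| |v| >= m^2, the squared distance of the directions is 2 |u| |v| - 2 u.v, which
    is at most |u - v|^2 because 2 |u| |v| <= |u|^2 + |v|^2. *)
Lemma enorm_normalizeB u v m : 0 < m -> m <= enorm u -> m <= enorm v ->
  enorm (normalize u - normalize v) <= enorm (u - v) / m.
Proof.
move=> m0 mu mv.
have nu0 : 0 < enorm u by exact: lt_le_trans mu.
have nv0 : 0 < enorm v by exact: lt_le_trans mv.
rewrite -ler_sqr ?nnegrE ?divr_ge0 ?enorm_ge0 ?(ltW m0)//.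
rewrite expr_div_n ler_pdivlMr ?exprn_gt0//.
have mm : m ^+ 2 <= enorm u * enorm v by rewrite expr2 ler_pM// ltW.
apply: le_trans (ler_wpM2l (sqr_ge0 _) mm) _.
have -> : enorm (normalize u - normalize v) ^+ 2 =
    2 - 2 * (dotp u v / (enorm u * enorm v)).
  rewrite enorm_sqr !(dotpBl, dotpBr, dotpZl, dotpZr) (dotpC v u) -!enorm_sqr.
  by field; rewrite !gt_eqF.
rewrite enorm_sqr !(dotpBl, dotpBr) (dotpC v u) -!enorm_sqr.
have -> : (2 - 2 * (dotp u v / (enorm u * enorm v))) * (enorm u * enorm v) =
    2 * (enorm u * enorm v) - 2 * dotp u v by field; rewrite !gt_eqF.
by have := sqr_ge0 (enorm u - enorm v); rewrite sqrrB; lra.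
Qed.

End euclidean.

(** * Distance on the unit sphere *)

Section angle.
Variables (R : realType) (n : nat).
Implicit Types (u v w : 'rV[R]_n) (a b : R).

Definition angle u v : R := acos (dotp u v).

Lemma dotp_unit u v : enorm u = 1 -> enorm v = 1 -> -1 <= dotp u v <= 1.
Proof.
move=> u1 v1; rewrite -ler_norml.
rewrite -ler_sqr ?nnegrE//.
rewrite real_normK ?num_real// expr1n.
by rewrite (le_trans (dotp_sqr_le _ _))// -!enorm_sqr u1 v1 expr1n mulr1.
Qed.

Lemma cos_angle u v : enorm u = 1 -> enorm v = 1 -> cos (angle u v) = dotp u v.
Proof. by move=> u1 v1; rewrite acosK// in_itv/= dotp_unit. Qed.

Lemma angle_ge0 u v : enorm u = 1 -> enorm v = 1 -> 0 <= angle u v.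
Proof. by move=> u1 v1; rewrite acos_ge0// dotp_unit. Qed.

Lemma angle_lepi u v : enorm u = 1 -> enorm v = 1 -> angle u v <= pi.
Proof. by move=> u1 v1; rewrite acos_lepi// dotp_unit. Qed.

Lemma angleC u v : angle u v = angle v u.
Proof. by rewrite /angle dotpC. Qed.

Lemma cos_lt a b : 0 <= a -> a < b -> b <= pi -> cos b < cos a :> R.
Proof.
move=> a0 ab bpi; rewrite ltr_cos// in_itv/=.
  by rewrite a0 (ltW (lt_le_trans ab bpi)).
by rewrite (ltW (le_lt_trans a0 ab)).
Qed.

Lemma cos_le a b : 0 <= a -> a <= b -> b <= pi -> cos b <= cos a :> R.
Proof.
move=> a0; rewrite le_eqVlt => /predU1P[->//|ab] bpi.
exact/ltW/cos_lt.
Qed.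

(** For Fenchel's argument: a point whose angles to two given points add up to at most s < pi has a
    positive product with their sum. Monotonicity of cos replaces b by s - a; with s = 2 h and a = h
    + t the sum is 2 cos h cos t, and |t| <= h gives at least 2 (cos h)^2 = 1 + cos s. *)
Lemma sum_cos_ge a b s : 0 <= a -> 0 <= b -> a + b <= s -> s <= pi ->
  1 + cos s <= cos a + cos b :> R.
Proof.
move=> a0 b0 abs spi.
have bs : cos (s - a) <= cos b by apply: cos_le; lra.
apply: le_trans (lerD (lexx (cos a)) bs).
have [h [t [aE sE]]] : exists h t, a = h + t /\ s = h + h.
  by exists (s / 2), (a - s / 2); split; lra.
move: a0 abs spi; rewrite {}aE {}sE => a0 abs spi.
rewrite (_ : h + h - (h + t) = h - t); last by ring.
rewrite cosB !cosD -!expr2 sin2cos2.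
have ch0 : 0 <= cos h by apply: cos_ge0_pihalf; apply/andP; lra.
have ct : cos h <= cos t.
  have [t0|t0] := leP 0 t; first by apply: cos_le; lra.
  by rewrite -(cosN t); apply: cos_le; lra.
by have := ler_wpM2l ch0 ct; rewrite -expr2; lra.
Qed.

(** If this failed, applying cos and the addition formula would contradict Cauchy-Schwarz for the
    components of u and w orthogonal to v, whose norms are the sines of the two angles. *)
Lemma angle_triangle u v w : enorm u = 1 -> enorm v = 1 -> enorm w = 1 ->
  angle u w <= angle u v + angle v w.
Proof.
move=> u1 v1 w1; rewrite leNgt; apply/negP => h.
have uv0 := angle_ge0 u1 v1; have vw0 := angle_ge0 v1 w1.
have uwpi := angle_lepi u1 w1.
have := cos_lt (addr_ge0 uv0 vw0) h uwpi.
rewrite cosD !cos_angle// !sin_acos ?dotp_unit//.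
apply/negP; rewrite -leNgt.
set s := Num.sqrt _; set t := Num.sqrt _.
have uv1 : dotp u v ^+ 2 <= 1.
  by have := dotp_sqr_le u v; rewrite -!enorm_sqr u1 v1 expr1n mulr1.
have vw1 : dotp v w ^+ 2 <= 1.
  by have := dotp_sqr_le v w; rewrite -!enorm_sqr v1 w1 expr1n mulr1.
suff : dotp u v * dotp v w - dotp u w <= s * t by lra.
apply: le_trans (ler_norm _) _.
rewrite -ler_sqr ?nnegrE ?mulr_ge0 ?sqrtr_ge0//.
rewrite real_normK ?num_real// exprMn !sqr_sqrtr ?subr_ge0//.
have := dotp_sqr_le (u - dotp u v *: v) (w - dotp v w *: v).
rewrite !(dotpBl, dotpBr, dotpZl, dotpZr) (dotpC v u) (dotpC w v) -!enorm_sqr.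
by rewrite u1 v1 w1 !expr1n; lra.
Qed.

Lemma sin_ge_mulcos a : 0 <= a -> a <= pi / 2 -> a * cos a <= sin a :> R.
Proof.
rewrite le_eqVlt => /predU1P[<-|a0] api; first by rewrite mul0r sin0.
have [|c] := @MVT R sin cos 0 a a0.
  by apply: continuous_subspaceT => x; exact: continuous_sin.
rewrite in_itv/= => /andP[c0 ca]; rewrite sin0 !subr0 mulrC => ->.
have : cos a < cos c by apply: cos_lt; rewrite ?ltW//; have := pi_gt0 R; lra.
by move=> h; rewrite ler_wpM2l ?ltW.
Qed.

Lemma sin_le_id a : 0 <= a -> sin a <= a :> R.
Proof.
rewrite le_eqVlt => /predU1P[<-|a0]; first by rewrite sin0.
have [|c] := @MVT R sin cos 0 a a0.
  by apply: continuous_subspaceT => x; exact: continuous_sin.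
rewrite sin0 !subr0 => _ ->.
by rewrite -[leRHS]mul1r ler_wpM2r ?cos_le1// ltW.
Qed.

Lemma cos_ge_quadratic a : 0 <= a -> 1 - a ^+ 2 / 2 <= cos a :> R.
Proof.
move=> a0; have h0 : 0 <= a / 2 by rewrite divr_ge0.
have -> : a = a / 2 + a / 2 by lra.
rewrite cosD -expr2 cos2sin2 -expr2.
have : sin (a / 2) ^+ 2 <= (a / 2) ^+ 2.
  have [s0|s0] := leP 0 (sin (a/2)).
    by rewrite lerXn2r ?nnegrE// sin_le_id.
  have := sin_le_id h0.
  have : - (a / 2) <= sin (a / 2).
    have [ap|ap] := leP (a / 2) 1.
      have : 0 <= sin (a / 2).
        apply: sin_ge0_pi; rewrite h0/=.
        by have := pi_ge2 R; lra.
      lra.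
    by have := sin_geN1 (a / 2); lra.
  by nra.
nra.
Qed.

(* The cubic error term disappears when the estimate is summed over the small
   steps of a fine partition. *)
Lemma angle_le_chord u v : enorm u = 1 -> enorm v = 1 -> enorm (u - v) <= 1 ->
  angle u v <= enorm (u - v) + enorm (u - v) ^+ 3.
Proof.
move=> u1 v1; set D := enorm _ => D1.
have D0 : 0 <= D by exact: enorm_ge0.
have t0 := angle_ge0 u1 v1; have tpi := angle_lepi u1 v1.
have D2 : D ^+ 2 = 2 - 2 * cos (angle u v).
  rewrite cos_angle// enorm_sqr !(dotpBl, dotpBr) (dotpC v u) -!enorm_sqr u1 v1.
  by lra.
move: t0 tpi D2; set t := angle u v => t0 tpi D2.
have D2' : D ^+ 2 = (2 * sin (t / 2)) ^+ 2.
  rewrite D2 (_ : cos t = cos (t / 2 + t / 2)); last by congr cos; lra.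
  by rewrite cosD -!expr2 cos2sin2; lra.
have h0 : 0 <= t / 2 by rewrite divr_ge0.
have s0 : 0 <= sin (t / 2).
  by apply: sin_ge0_pi; rewrite h0/=; have := pi_gt0 R; lra.
have DE : D = 2 * sin (t / 2).
  by apply/eqP; rewrite -(eqrXn2 (ltn0Sn 1)) ?D2'// mulr_ge0.
(* An obtuse angle has a chord longer than sqrt 2, against [D1]. *)
have tpi2 : t <= pi / 2.
  rewrite leNgt; apply/negP => h.
  have := cos_lt _ h tpi; rewrite cos_pihalf; have := pi_gt0 R => pi0 hh.
  have : cos t < 0 by apply: hh; lra.
  by nra.
have pi0 := pi_gt0 R.
have c1 := sin_ge_mulcos h0; have {c1} c1 : t / 2 * cos (t / 2) <= sin (t / 2).
  by apply: c1; lra.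
have c2 : 1 - (t / 2) ^+ 2 / 2 <= cos (t / 2) by exact: cos_ge_quadratic.
(* This crude bound turns the cubic term of t (1 - t^2 / 8) <= D into t^3 / 8 <= D^3. *)
have tb : t <= 2 * D.
  suff ch : 2^-1 <= cos (t / 2) by nra.
  have : 0 <= cos (t / 2) by apply: cos_ge0_pihalf; apply/andP; lra.
  have : cos t = 2 * cos (t / 2) ^+ 2 - 1.
    rewrite {1}(_ : t = t / 2 + t / 2) ?cosD -?expr2 ?sin2cos2; last lra.
    lra.
  by nra.
have : t * (1 - t ^+ 2 / 8) <= D by nra.
have : t ^+ 3 <= 8 * D ^+ 3.
  have : t ^+ 3 <= (2 * D) ^+ 3 by rewrite lerXn2r ?nnegrE ?mulr_ge0.
  by rewrite exprMn; lra.
by rewrite !exprS expr0; lra.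
Qed.

End angle.

(** * Integrals over intervals *)

Section integrals.
Variable R : realType.
Notation mu := (@lebesgue_measure R).
Implicit Types (a b c h x y : R).

Lemma measurable_inv : measurable_fun setT (fun x : R => x^-1).
Proof.
(* Squaring moves the argument of [powR] to the nonnegative reals; at x = 0 both sides are 0. *)
have -> : (fun x => x^-1) = (fun x => x * powR (x ^+ 2) (-1)).
  apply/funext => x; rewrite powR_inv1 ?sqr_ge0//.
  have [->|x0] := eqVneq x 0; first by rewrite invr0 mul0r.
  by rewrite expr2; field.
apply: measurable_funM => //.
apply: (measurableT_comp (measurable_powR (-1))); exact: exprn_measurable.
Qed.

Definition measurable_vec d (T : measurableType d) n (f : T -> 'rV[R]_n) :=
  forall i, measurable_fun setT (fun x : T => f x 0 i).

Section measurable_vectors.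
Context d (T : measurableType d) (n : nat).
Implicit Types f g : T -> 'rV[R]_n.

Lemma measurable_vecB f g : measurable_vec f -> measurable_vec g ->
  measurable_vec (fun x : T => f x - g x).
Proof.
move=> mf mg i; have -> : (fun x : T => (f x - g x) 0 i) =
  (fun x : T => f x 0 i) \- (fun x : T => g x 0 i) by apply/funext => x; rewrite !mxE.
exact: measurable_funB.
Qed.

Lemma measurable_vecZ (k : T -> R) f : measurable_fun setT k ->
  measurable_vec f -> measurable_vec (fun x : T => k x *: f x).
Proof.
move=> mk mf i; have -> : (fun x : T => (k x *: f x) 0 i) =
  k \* (fun x : T => f x 0 i) by apply/funext => x; rewrite !mxE.
exact: measurable_funM.
Qed.

Lemma measurable_vec_comp d' (T' : measurableType d') (phi : T' -> T) f :
  measurable_fun setT phi -> measurable_vec f -> measurable_vec (f \o phi).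
Proof. by move=> mphi mf i; apply: measurableT_comp (mf i) mphi. Qed.

Lemma measurable_enorm f : measurable_vec f ->
  measurable_fun setT (fun x : T => enorm (f x)).
Proof.
move=> mf; have ms : measurable_fun setT (@Num.sqrt R).
  by apply: continuous_measurable_fun; exact: sqrt_continuous.
apply: (measurableT_comp ms).
by apply: measurable_sum => i; exact: measurable_funX.
Qed.

Lemma measurable_dotp f g : measurable_vec f -> measurable_vec g ->
  measurable_fun setT (fun x : T => dotp (f x) (g x)).
Proof. by move=> mf mg; apply: measurable_sum => i; exact: measurable_funM. Qed.

Lemma measurable_normalize f : measurable_vec f ->
  measurable_vec (fun x : T => normalize (f x)).
Proof.
move=> mf; apply: measurable_vecZ => //.
by apply: measurableT_comp; [exact: measurable_inv|exact: measurable_enorm].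
Qed.

End measurable_vectors.

Lemma measurable_shift h : measurable_fun setT (fun x : R => x + h).
Proof. exact: measurable_funD. Qed.

(** The pushforward under the shift agrees with Lebesgue measure on half-open intervals, which
    determine it. *)
Lemma lebesgue_measure_shift h (A : set R) : measurable A ->
  mu ((fun x => x + h) @^-1` A) = mu A.
Proof.
move=> mA; apply/esym.
have mh : measurable_fun setT (fun x : R => x + h : measurableTypeR R).
  exact: measurable_shift.
pose m : {measure set (measurableTypeR R) -> \bar R} :=
  measure_function_pushforward__canonical__measure_function_Measure mu mh.
rewrite (lebesgue_measure_unique (mu := m))//.
move=> X [[a b] _ <-] /=; rewrite /pushforward /=.
have -> : (fun x => x + h) @^-1` `]a, b] = [set` `]a - h, b - h]].
  by apply/seteqP; split => x /=; rewrite !in_itv/= ltrBlDr lerBrDr.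
rewrite !lebesgue_measure_itv/= !lte_fin ltrD2r.
by case: ifPn => // _; rewrite -!EFinD; congr EFin; ring.
Qed.

Lemma ge0_integral_shift h (D : set R) (f : R -> \bar R) : measurable D ->
  measurable_fun setT f -> (forall x, 0 <= f x)%E ->
  (\int[mu]_(x in D) f x = \int[mu]_(x in (fun x => (x + h)%R) @^-1` D) f (x + h)%R)%E.
Proof.
move=> mD mf f0.
have mh : measurable_fun setT (fun x : R => x + h : measurableTypeR R).
  exact: measurable_shift.
pose m : {measure set (measurableTypeR R) -> \bar R} :=
  measure_function_pushforward__canonical__measure_function_Measure mu mh.
transitivity (\int[m]_(x in D) f x)%E.
  by apply: eq_measure_integral => A mA _; apply/esym/lebesgue_measure_shift.
rewrite (@ge0_integral_pushforward _ _ (measurableTypeR R) (measurableTypeR R) R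
  _ mh mu D f)//.
exact: measurable_funTS.
Qed.

Lemma ge0_integral_itv_shift h a b (f : R -> \bar R) :
  measurable_fun setT f -> (forall x, 0 <= f x)%E ->
  (\int[mu]_(x in `[a, b]) f (x + h)%R = \int[mu]_(x in `[(a + h)%R, (b + h)%R]) f x)%E.
Proof.
move=> mf f0; rewrite [RHS](ge0_integral_shift h)//; congr (integral _ _ _).
by apply/seteqP; split => x /=; rewrite !in_itv/= !lerD2r.
Qed.

Lemma ge0_integral_itvD a b c (f : R -> \bar R) : a <= b -> b <= c ->
  measurable_fun setT f -> (forall x, 0 <= f x)%E ->
  (\int[mu]_(x in `[a, c]) f x =
   \int[mu]_(x in `[a, b]) f x + \int[mu]_(x in `[b, c]) f x)%E.
Proof.
move=> ab bc mf f0.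
have -> : `[a, c]%classic = (`[a, b] `|` `]b, c])%classic.
  by rewrite -itv_bndbnd_setU// bnd_simp.
rewrite ge0_integral_setU//.
- congr (_ + _)%E; rewrite integral_itv_obnd_cbnd//; exact: measurable_funTS.
- exact: measurable_funTS.
- apply/disj_setPRL => x /=; rewrite !in_itv/= => /andP[bx _].
  by move=> /andP[_]; rewrite leNgt bx.
Qed.

(** The window [h, h + 1] is cut at 1, and the part beyond 1 is moved back by one period. *)
Lemma ge0_periodic_integral h (f : R -> \bar R) : 0 <= h <= 1 ->
  measurable_fun setT f -> (forall x, 0 <= f x)%E ->
  (forall x, f (x + 1)%R = f x) ->
  (\int[mu]_(x in `[0%R, 1%R]) f (x + h)%R = \int[mu]_(x in `[0%R, 1%R]) f x)%E.
Proof.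
move=> /andP[h0 h1] mf f0 per; rewrite ge0_integral_itv_shift// add0r.
rewrite (ge0_integral_itvD h1 _ mf f0) ?lerDl//.
rewrite [RHS](ge0_integral_itvD h0 h1 mf f0) addeC; congr (_ + _)%E.
rewrite -[in LHS](add0r 1) (addrC _ h) add0r -[X in `[X, _]](add0r 1).
rewrite -ge0_integral_itv_shift//.
by apply: eq_integral => x _; rewrite per.
Qed.

Lemma tonelli_itv (f : measurableTypeR R * measurableTypeR R -> \bar R)
    a b c (d : R) : measurable_fun setT f ->
  (forall z, 0 <= f z)%E ->
  ((\int[mu \x mu]_(z in `[a, b] `*` `[c, d]) f z =
   \int[mu]_(x in `[a, b]) \int[mu]_(y in `[c, d]) f (x, y))%E *
  (\int[mu]_(x in `[a, b]) \int[mu]_(y in `[c, d]) f (x, y) =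
   \int[mu]_(y in `[c, d]) \int[mu]_(x in `[a, b]) f (x, y))%E)%type.
Proof.
move=> mf f0.
pose g := f \_ (`[a, b] `*` `[c, d]).
have mg : measurable_fun setT g.
  by apply/(measurable_restrictT _ _).1; [exact: measurableX|exact: measurable_funTS].
have g0 z : (0 <= g z)%E by rewrite /g patchE; case: ifP.
have E1 : (\int[mu]_x \int[mu]_y g (x, y) =
    \int[mu]_(x in `[a, b]) \int[mu]_(y in `[c, d]) f (x, y))%E.
  rewrite [RHS]integral_mkcond; apply: eq_integral => x _.
  rewrite patchE; case: ifPn => xab.
    rewrite [RHS]integral_mkcond; apply: eq_integral => y _.
    by rewrite /g !patchE in_setX/= xab.
  by rewrite integral0_eq// => y _; rewrite /g patchE in_setX/= (negbTE xab).
have E2 : (\int[mu]_y \int[mu]_x g (x, y) =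
    \int[mu]_(y in `[c, d]) \int[mu]_(x in `[a, b]) f (x, y))%E.
  rewrite [RHS]integral_mkcond; apply: eq_integral => x _.
  rewrite patchE; case: ifPn => xab.
    rewrite [RHS]integral_mkcond; apply: eq_integral => y _.
    by rewrite /g !patchE in_setX/= xab andbT.
  by rewrite integral0_eq// => y _; rewrite /g patchE in_setX/= (negbTE xab) andbF.
split; first by rewrite integral_mkcond -E1 -fubini_tonelli1.
rewrite -E1 -E2.
by rewrite [LHS](@fubini_tonelli _ _ (measurableTypeR R) (measurableTypeR R) R
  mu mu g mg).
Qed.

Lemma measurable_integral_itv
    (f : measurableTypeR R * measurableTypeR R -> \bar R) c (d : R) :
  measurable_fun setT f ->
  (forall z, 0 <= f z)%E ->
  measurable_fun setT (fun x => \int[mu]_(y in `[c, d]) f (x, y))%E.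
Proof.
move=> mf f0; pose g := f \_ (setT `*` `[c, d]).
have mg : measurable_fun setT g.
  by apply/(measurable_restrictT _ _).1; [exact: measurableX|exact: measurable_funTS].
have g0 z : (0 <= g z)%E by rewrite /g patchE; case: ifP.
have -> : (fun x => \int[mu]_(y in `[c, d]) f (x, y))%E = fubini_F mu g.
  apply/funext => x; rewrite integral_mkcond; apply: eq_integral => y _.
  by rewrite /g !patchE in_setX/= in_setT.
exact: measurable_fun_fubini_tonelli_F.
Qed.

End integrals.

(** Over m equal steps the increments of [V] telescope, while the quadratic errors add up to C (y -
    x)^2 / m, which tends to 0. *)
Lemma local_to_global (R : realType) (d : R -> R -> R) (V : R -> R) (C del : R) :
  0 < del -> 0 <= C ->
  (forall x y z, 0 <= x -> x <= y -> y <= z -> z <= 1 -> d x z <= d x y + d y z) ->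
  (forall x y, 0 <= x -> x <= y -> y <= 1 -> y - x <= del ->
    d x y <= V y - V x + C * (y - x) ^+ 2) ->
  forall x y, 0 <= x -> x <= y -> y <= 1 -> d x y <= V y - V x.
Proof.
move=> del0 C0 tri loc x y x0 xy y1; rewrite leNgt; apply/negP => h.
have yx0 : 0 <= y - x by rewrite subr_ge0.
pose g := d x y - (V y - V x).
have g0 : 0 < g by rewrite subr_gt0.
(* The first summand makes each step at most [del], the second makes the total error smaller than
   the supposed excess [g]. *)
pose m := (Num.truncn ((y - x) / del + C * (y - x) ^+ 2 / g)).+1.
have hm : (y - x) / del + C * (y - x) ^+ 2 / g < m%:R by exact: truncnS_gt.
have p1 : 0 <= (y - x) / del by rewrite divr_ge0 ?(ltW del0).
have p2 : 0 <= C * (y - x) ^+ 2 / g by rewrite divr_ge0 ?mulr_ge0 ?sqr_ge0 ?(ltW g0).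
have m0 : 0 < m%:R :> R by rewrite ltr0n.
pose eta := (y - x) / m%:R.
have eta0 : 0 <= eta by rewrite divr_ge0 ?(ltW m0).
have etad : eta <= del.
  rewrite ler_pdivrMr//.
  have : (y - x) / del <= m%:R by lra.
  by rewrite ler_pdivrMr// mulrC.
have etaC : m%:R * (C * eta ^+ 2) < g.
  have : C * (y - x) ^+ 2 / g < m%:R by lra.
  rewrite ltr_pdivrMr// => hh.
  have -> : m%:R * (C * eta ^+ 2) = C * (y - x) ^+ 2 / m%:R.
    by rewrite /eta; field; rewrite gt_eqF.
  by rewrite ltr_pdivrMr// (mulrC g).
have etam : x + m%:R * eta = y by rewrite /eta; field; rewrite gt_eqF.
have step k : (k <= m)%N ->
    d x (x + k%:R * eta) <= V (x + k%:R * eta) - V x + k%:R * (C * eta ^+ 2).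
  elim: k => [_|k IH km].
    have := loc x x x0 (lexx x) (le_trans xy y1).
    by rewrite !mul0r !addr0 !subrr expr0n mulr0 addr0; apply; exact: ltW.
  have kE : k.+1%:R * eta = k%:R * eta + eta by rewrite -natr1; ring.
  have km' : k.+1%:R * eta <= m%:R * eta by rewrite ler_wpM2r ?ler_nat.
  have ke0 : 0 <= k%:R * eta by rewrite mulr_ge0.
  have := IH (ltnW km).
  have := @tri x (x + k%:R * eta) (x + k.+1%:R * eta) x0.
  have := @loc (x + k%:R * eta) (x + k.+1%:R * eta).
  have -> : x + k.+1%:R * eta - (x + k%:R * eta) = eta by rewrite kE; ring.
  have -> : k.+1%:R * (C * eta ^+ 2) = k%:R * (C * eta ^+ 2) + C * eta ^+ 2.
    by rewrite -natr1; ring.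
  move=> l1 l2 l3.
  have {}l1 := l1 ltac:(lra) ltac:(lra) ltac:(lra) etad.
  have {}l2 := l2 ltac:(lra) ltac:(lra) ltac:(lra).
  lra.
have := step m (leqnn m); rewrite etam => {}step.
by move: etaC; rewrite /g; lra.
Qed.

Section interval_integrals.
Variable R : realType.
Notation mu := (@lebesgue_measure R).

Lemma bounded_integrable_itv (f : R -> R) K a b : measurable_fun setT f ->
  (forall x, `|f x| <= K) -> mu.-integrable `[a, b] (EFin \o f).
Proof.
move=> mf fK; apply: measurable_bounded_integrable => //.
- rewrite /= lebesgue_measure_itv/=; case: ifPn => // _.
  by rewrite -EFinB ltry.
- exact: measurable_funTS.
- exists K; split; first exact: num_real.
  by move=> x Kx y _ /=; exact: le_trans (fK y) (ltW Kx).
Qed.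

Lemma Rintegral_itvD (f : R -> R) a b c : a <= b -> b <= c ->
  mu.-integrable `[a, c] (EFin \o f) ->
  \int[mu]_(x in `[a, c]) f x =
  \int[mu]_(x in `[a, b]) f x + \int[mu]_(x in `[b, c]) f x.
Proof.
move=> ab bc intf.
have := @Rintegral_itvB _ f (BLeft a) (BRight c) b intf.
rewrite !bnd_simp => /(_ ab bc) h.
rewrite -(Rintegral_itv_obnd_cbnd (r := b)) -?h; first by rewrite addrC subrK.
by apply: integrableS intf => //; apply: subset_itvr; rewrite bnd_simp.
Qed.

Lemma Rintegral_itv_cst (a b k : R) : a <= b ->
  \int[mu]_(x in `[a, b]) k = k * (b - a).
Proof.
move=> ab; rewrite Rintegral_cst//= lebesgue_measure_itv/= lte_fin.
case: ltP => [//|ba]; rewrite (le_anti (introT andP (conj ab ba))).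
by rewrite subrr.
Qed.

Lemma integrable_sub_itv (f : R -> R) a b c (d : R) : a <= c -> d <= b ->
  mu.-integrable `[a, b] (EFin \o f) -> mu.-integrable `[c, d] (EFin \o f).
Proof.
move=> ac db; apply: integrableS => // x; rewrite /= !in_itv/= => /andP[cx xd].
by rewrite (le_trans ac cx) (le_trans xd db).
Qed.

Lemma le_Rintegral_sub_itv (f : R -> R) a b c (d : R) :
  a <= c -> c <= d -> d <= b ->
  mu.-integrable `[a, b] (EFin \o f) -> (forall x, 0 <= f x) ->
  \int[mu]_(x in `[c, d]) f x <= \int[mu]_(x in `[a, b]) f x.
Proof.
move=> ac cd db intf f0.
rewrite (Rintegral_itvD ac (le_trans cd db) intf).
rewrite (Rintegral_itvD cd db); last exact: integrable_sub_itv intf.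
by rewrite addrCA lerDl addr_ge0// Rintegral_ge0.
Qed.

Lemma Rintegral_itv_le (f : R -> R) K a b : a <= b ->
  measurable_fun setT f -> (forall x, `|f x| <= K) ->
  `|\int[mu]_(x in `[a, b]) f x| <= K * (b - a).
Proof.
move=> ab mf fK; have intf := bounded_integrable_itv a b mf fK.
apply: le_trans (le_normr_Rintegral _ intf) _ => //.
rewrite -Rintegral_itv_cst//; apply: le_Rintegral => //.
- apply: (@bounded_integrable_itv (fun x => `|f x|) K).
    exact: measurableT_comp.
  by move=> x; rewrite normr_id.
- apply: (@bounded_integrable_itv (fun _ => K) `|K|) => //.
Qed.

Lemma integrable_scaler (D : set (measurableTypeR R)) (f : R -> R) r : measurable D ->
  mu.-integrable D (EFin \o f) -> mu.-integrable D (EFin \o (fun x : R => r * f x)).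
Proof.
move=> mD intf; have := integrableZl mD r intf.
by apply: eq_integrable => // x _; rewrite /= EFinM.
Qed.

Lemma integrable_addr (D : set (measurableTypeR R)) (f g : R -> R) : measurable D ->
  mu.-integrable D (EFin \o f) -> mu.-integrable D (EFin \o g) ->
  mu.-integrable D (EFin \o (fun x : R => f x + g x)).
Proof.
by move=> mD intf intg; have := @integrableD _ _ _ mu D mD _ _ intf intg; apply.
Qed.

Lemma integrable_subr (D : set (measurableTypeR R)) (f g : R -> R) : measurable D ->
  mu.-integrable D (EFin \o f) -> mu.-integrable D (EFin \o g) ->
  mu.-integrable D (EFin \o (fun x : R => f x - g x)).
Proof.
by move=> mD intf intg; have := @integrableB _ _ _ mu D mD _ _ intf intg; apply.
Qed.

Lemma Rintegral_dotp n (f : R -> 'rV[R]_n) (e v : 'rV[R]_n)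
  (D : set (measurableTypeR R)) :
  measurable D ->
  (forall i, mu.-integrable D (EFin \o (fun x : R => f x 0 i))) ->
  (forall i, v 0 i = \int[mu]_(x in D) f x 0 i) ->
  \int[mu]_(x in D) dotp (f x) e = dotp v e.
Proof.
move=> mD intf vE.
have intfe i : mu.-integrable D (EFin \o (fun x : R => f x 0 i * e 0 i)).
  rewrite [X in EFin \o X](_ : _ = fun x : R => e 0 i * f x 0 i); last first.
    by apply/funext => x; rewrite mulrC.
  exact: integrable_scaler.
rewrite /dotp /Rintegral.
under eq_integral do rewrite -sumEFin.
rewrite (@integral_sum _ _ _ mu D mD _ (fun i => EFin \o (fun x => f x 0 i * e 0 i)))//.
rewrite -sum_fine; last by move=> i _; exact: integrable_fin_num.
by apply: eq_bigr => i _; rewrite vE -RintegralZr.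
Qed.

(* Testing against the direction of the increment turns the norm of the
   integral into the integral of a scalar function. *)
Lemma enorm_Rintegral_le n (f : R -> 'rV[R]_n) (v : 'rV[R]_n) K a b :
  measurable_vec f -> (forall x, enorm (f x) <= K) ->
  (forall i, v 0 i = \int[mu]_(x in `[a, b]) f x 0 i) ->
  enorm v <= \int[mu]_(x in `[a, b]) enorm (f x).
Proof.
move=> mf fK vE.
have [->|v0] := eqVneq v 0.
  by rewrite enorm0 Rintegral_ge0// => x _; exact: enorm_ge0.
have <- : dotp v (normalize v) = enorm v.
  by rewrite dotpZr -enorm_sqr; field; rewrite enorm_eq0.
rewrite -(@Rintegral_dotp _ f _ _ `[a, b]%classic _ _ vE)//; last first.
  move=> i; apply: (bounded_integrable_itv (K := K)); first exact: mf.
  by move=> x; exact: le_trans (le_coord_enorm _ _) (fK x).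
have fe x : `|dotp (f x) (normalize v)| <= K.
  have h u : dotp (f x) u <= enorm (f x) * enorm u by exact: dotp_le.
  rewrite ler_norml; apply/andP; split.
    have := h (- normalize v); rewrite enormN enorm_normalize// mulr1.
    rewrite -scaleN1r dotpZr mulN1r => h1.
    by have := fK x; lra.
  have := h (normalize v); rewrite enorm_normalize// mulr1 => h1.
  exact: le_trans h1 (fK x).
apply: le_Rintegral => //.
- apply: (bounded_integrable_itv (K := K)) => //.
  by apply: measurable_dotp => // i; exact: measurable_cst.
- apply: (bounded_integrable_itv (K := K)); first exact: measurable_enorm.
  by move=> x; rewrite ger0_norm ?enorm_ge0.
- by move=> x _; apply: le_trans (dotp_le _ _) _; rewrite enorm_normalize// mulr1.
Qed.

End interval_integrals.

(** * Closed curves with mean zero *)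

Section mean_zero_curve.
Variables (R : realType) (n : nat) (F f : R -> 'rV[R]_n) (K : R).
Notation mu := (@lebesgue_measure R).
Hypotheses (mF : measurable_vec F) (mf : measurable_vec f).
Hypothesis fK : forall x, enorm (f x) <= K.
Hypothesis FE : forall (x y : R) i, 0 <= x -> x <= y -> y <= 1 ->
  F y 0 i - F x 0 i = \int[mu]_(z in `[x, y]) f z 0 i.

(** An upper bound for the speed of the direction of [F]. By the convention for division it is 0 at
    the zeros of [F], so it controls |f| only where [F] is nonzero. *)
Definition relspeed (x : R) : R := enorm (f x) / enorm (F x).
Local Notation w := relspeed.

Let K0 : 0 <= K. Proof. exact: le_trans (enorm_ge0 _) (fK 0). Qed.

Lemma relspeed_ge0 x : 0 <= w x.
Proof. by rewrite divr_ge0// enorm_ge0. Qed.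

Lemma measurable_relspeed : measurable_fun setT w.
Proof.
apply: measurable_funM; first exact: measurable_enorm.
by apply: measurableT_comp; [exact: measurable_inv|exact: measurable_enorm].
Qed.

Let mnf : measurable_fun setT (fun x => enorm (f x)).
Proof. exact: measurable_enorm. Qed.

Let nfK x : `|enorm (f x)| <= K.
Proof. by rewrite ger0_norm ?enorm_ge0. Qed.

Lemma curve_incr_le x y : 0 <= x -> x <= y -> y <= 1 ->
  enorm (F y - F x) <= \int[mu]_(z in `[x, y]) enorm (f z).
Proof.
move=> x0 xy y1; apply: enorm_Rintegral_le => // i.
by rewrite !mxE FE.
Qed.

Lemma curve_lipschitz x y : 0 <= x <= 1 -> 0 <= y <= 1 ->
  enorm (F y - F x) <= K * `|y - x|.
Proof.
wlog xy : x y / x <= y => [H|].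
  move=> xi yi; have [xy|/ltW yx] := leP x y; first exact: H.
  by rewrite enorm_distC distrC H.
move=> /andP[x0 _] /andP[_ y1].
apply: le_trans (curve_incr_le x0 xy y1) _.
rewrite ger0_norm ?subr_ge0//.
exact: le_trans (ler_norm _) (Rintegral_itv_le xy mnf nfK).
Qed.

Lemma curve_norm_continuous p q : 0 <= p -> q <= 1 ->
  {within `[p, q], continuous (fun x => enorm (F x))}.
Proof.
move=> p0 q1; apply/subspace_continuousP => x; rewrite /= in_itv/= => /andP[px xq].
apply/cvgrPdist_le => /= e e0.
near=> y.
have : `[p, q]%classic y by near: y; exact: withinT.
rewrite /= in_itv/= => /andP[py yq].
have xy : `|x - y| < e / (K + 1).
  near: y; apply: cvg_within; apply: (@cvgr_dist_lt _ _ _ (nbhs x) _ id) => //.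
  by rewrite divr_gt0// ltr_wpDl.
have h u v : enorm u - enorm v <= enorm (u - v) := @lerB_enorm R n u v.
have xi : 0 <= x <= 1 by lra.
have yi : 0 <= y <= 1 by lra.
have := curve_lipschitz yi xi; have := h (F x) (F y); have := h (F y) (F x).
rewrite [enorm (F y - F x)]enorm_distC => h1 h2 h3.
have : K * `|x - y| <= e.
  have : (K + 1) * `|x - y| <= e.
    by rewrite mulrC -ler_pdivlMr ?ltW// ltr_wpDl.
  by have := normr_ge0 (x - y); lra.
move=> h4; change (`|enorm (F x) - enorm (F y)| <= e).
by rewrite ler_norml; lra.
Unshelve. all: by end_near. Qed.

(** * Zeros of a curve with integrable relative speed *)

Section integrable_relspeed.
Hypothesis wi : mu.-integrable `[0, 1] (EFin \o w).

Let wi_sub x y : 0 <= x -> y <= 1 -> mu.-integrable `[x, y] (EFin \o w).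
Proof. by move=> x0 y1; exact: integrable_sub_itv wi. Qed.

(* Near a zero of F the increments of F are at most half of the local maximum
   of |F|. *)
Lemma vanish_near_zero p q : 0 <= p -> p <= q -> q <= 1 ->
  \int[mu]_(z in `[p, q]) w z <= 2^-1 ->
  (forall x, p < x < q -> F x != 0) -> F p = 0 \/ F q = 0 ->
  forall x, p <= x <= q -> F x = 0.
Proof.
move=> p0 pq q1 w2 Fn0 Fpq.
have [c] := EVT_max pq (curve_norm_continuous p0 q1).
rewrite in_itv/= => /andP[pc cq] cmax.
suff m0 : enorm (F c) <= 0.
  move=> x xpq; apply/eqP; rewrite -enorm_eq0 eq_le enorm_ge0 andbT.
  by apply: le_trans m0; apply: cmax; rewrite in_itv.
have incr x y : p <= x -> x <= y -> y <= q -> enorm (F y - F x) <= enorm (F c) / 2.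
  move=> px xy yq.
  have x0 : 0 <= x by exact: le_trans px.
  have y1 : y <= 1 by exact: le_trans q1.
  apply: le_trans (curve_incr_le x0 xy y1) _.
  apply: (@le_trans _ _ (\int[mu]_(z in `[p, q]) enorm (f z))).
    apply: le_Rintegral_sub_itv => // [|z]; last exact: enorm_ge0.
    exact: (bounded_integrable_itv _ _ mnf nfK).
  apply: (@le_trans _ _ (\int[mu]_(z in `[p, q]) (enorm (F c) * w z))); last first.
    rewrite RintegralZl//; last exact: wi_sub.
    by rewrite ler_wpM2l ?enorm_ge0.
  have intf a b : mu.-integrable `[a, b] (EFin \o (fun z => enorm (f z))).
    exact: (bounded_integrable_itv _ _ mnf nfK).
  have intw : mu.-integrable `[p, q] (EFin \o (fun z => enorm (F c) * w z)).
    by apply: integrable_scaler => //; exact: wi_sub.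
  have oosub : `]p, q[%classic `<=` `[p, q]%classic by exact: subset_itv_oo_cc.
  have oc : `]p, q]%classic `<=` `[p, q]%classic by exact: subset_itv_oc_cc.
  (* At an endpoint [F] may vanish, and there |f| <= |F c| * w can fail because w is 0; both
     endpoints are therefore removed from the domain. *)
  rewrite -!(Rintegral_itv_obnd_cbnd (r := p)); last 2 first.
    by apply: integrableS intw => //; exact: subset_itv_oc_cc.
    by apply: integrableS (intf p q) => //; exact: subset_itv_oc_cc.
  rewrite -!Rintegral_itv_bndo_bndc; last 2 first.
    by apply: integrableS intw => //; exact: subset_itv_oo_cc.
    by apply: integrableS (intf p q) => //; exact: subset_itv_oo_cc.
  apply: le_Rintegral => //.
  - by apply: integrableS (intf p q).
  - by apply: integrableS intw.
  - move=> z; rewrite /= in_itv/= => zpq.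
    have Fz : 0 < enorm (F z) by rewrite enorm_gt0 Fn0.
    rewrite {1}(_ : enorm (f z) = enorm (F z) * w z); last first.
      by rewrite /relspeed; field; rewrite gt_eqF.
    rewrite ler_wpM2r ?relspeed_ge0//; apply: cmax.
    by rewrite in_itv/=; lra.
have cle : enorm (F c) <= enorm (F c) / 2.
  case: Fpq => F0.
    by have := incr p c (lexx p) pc cq; rewrite F0 subr0.
  by have := incr c q pc cq (lexx q); rewrite F0 sub0r enormN.
by lra.
Qed.

(** Absolute continuity of the integral. The threshold 1/2 is the factor by which increments of [F]
    near a zero are smaller than the local maximum of |F|. *)
Lemma relspeed_integral_small : exists2 d : R, 0 < d &
  forall p q, 0 <= p -> p <= q -> q <= 1 -> q - p < d ->
    \int[mu]_(z in `[p, q]) w z <= 2^-1.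
Proof.
have wT : mu.-integrable setT (EFin \o (w \_ `[0, 1])).
  by rewrite -restrict_EFin; apply/integrable_restrict => //; rewrite setTI.
have h2 : (0 : R) < 2^-1 by rewrite invr_gt0.
have [d [d0 dP]] := integral_normr_continuous wT h2.
exists d => // p q p0 pq q1 qpd.
have := dP `[p, q]%classic; rewrite /= lebesgue_measure_itv/= lte_fin => {}dP.
apply: le_trans (ltW (dP _ _)) => //; last first.
  by case: ifPn => _; rewrite ?lte_fin// -EFinB lte_fin.
rewrite le_eqVlt; apply/orP; left; apply/eqP/eq_Rintegral => z.
rewrite inE/= in_itv/= => /andP[pz zq]; rewrite patchE ifT.
  by rewrite ger0_norm// relspeed_ge0.
by rewrite inE/= in_itv/= (le_trans p0 pz) (le_trans zq q1).
Qed.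

(** The infimum of the zeros to the right of [a] is itself a zero by the Lipschitz bound. It bounds
    an interval free of zeros, as the local vanishing argument requires. *)
Lemma first_zero a z : 0 <= a -> a <= z -> z <= 1 -> F a != 0 -> F z = 0 ->
  exists b, [/\ a < b, b <= z, F b = 0 & forall x, a <= x < b -> F x != 0].
Proof.
move=> a0 az z1 Fa Fz.
pose A := [set x : R | a <= x <= z /\ F x = 0].
have Az : A z by split => //; rewrite az lexx.
have infA : has_inf A by split; [exists z|exists a => x [/andP[]]].
have ib x : A x -> inf A <= x by apply: ge_inf; case: infA.
have ab : a <= inf A by apply: lb_le_inf; [exists z|move=> x [/andP[]]].
have bz : inf A <= z by exact: ib.
have Fb : F (inf A) = 0.
  apply/eqP; apply: contraT; rewrite -enorm_gt0 => eta0.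
  have [|x Ax xb] := @inf_adherent R A (enorm (F (inf A)) / (K + 1)) _ infA.
    by rewrite divr_gt0// ltr_wpDl.
  have bx := ib _ Ax; case: Ax => /andP[ax xz] Fx.
  have h1 : 0 <= inf A <= 1 by lra.
  have h2 : 0 <= x <= 1 by lra.
  have := curve_lipschitz h1 h2.
  rewrite Fx sub0r enormN ger0_norm ?subr_ge0//.
  have : x - inf A < enorm (F (inf A)) / (K + 1) by lra.
  rewrite ltr_pdivlMr ?ltr_wpDl// => h3 h4.
  have h5 : 0 <= x - inf A by rewrite subr_ge0.
  nra.
exists (inf A); split => //.
  by rewrite lt_neqAle ab andbT; apply: contra_neq Fa => ->.
move=> x /andP[ax]; apply: contraTneq => Fx; rewrite -leNgt.
have [xz|/ltW zx] := leP x z; last exact: le_trans zx.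
by apply: ib; split => //; rewrite ax.
Qed.

Lemma last_zero a z : 0 <= z -> z <= a -> a <= 1 -> F a != 0 -> F z = 0 ->
  exists b, [/\ z <= b, b < a, F b = 0 & forall x, b < x <= a -> F x != 0].
Proof.
move=> z0 za a1 Fa Fz.
pose A := [set x : R | z <= x <= a /\ F x = 0].
have Az : A z by split => //; rewrite za lexx.
have supA : has_sup A by split; [exists z|exists a => x [/andP[]]].
have ib x : A x -> x <= sup A by apply: ub_le_sup; case: supA.
have ba : sup A <= a by apply: ge_sup; [exists z|move=> x [/andP[]]].
have zb : z <= sup A by exact: ib.
have Fb : F (sup A) = 0.
  apply/eqP; apply: contraT; rewrite -enorm_gt0 => eta0.
  have [|x Ax xb] := @sup_adherent R A (enorm (F (sup A)) / (K + 1)) _ supA.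
    by rewrite divr_gt0// ltr_wpDl.
  have bx := ib _ Ax; case: Ax => /andP[zx xa] Fx.
  have h1 : 0 <= sup A <= 1 by lra.
  have h2 : 0 <= x <= 1 by lra.
  have := curve_lipschitz h2 h1.
  rewrite Fx subr0 ger0_norm ?subr_ge0//.
  have : sup A - x < enorm (F (sup A)) / (K + 1) by lra.
  rewrite ltr_pdivlMr ?ltr_wpDl// => h3 h4.
  have h5 : 0 <= sup A - x by rewrite subr_ge0.
  nra.
exists (sup A); split => //.
  by rewrite lt_neqAle ba andbT; apply: contra_neq Fa => <-.
move=> x /andP[+ xa]; apply: contraTneq => Fx; rewrite -leNgt.
have [zx|/ltW xz] := leP z x; last exact: le_trans xz zb.
by apply: ib; split => //; rewrite zx.
Qed.

(** The derivative of log |F| is bounded by the integrable [w], so log |F| cannot reach minus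
    infinity. Concretely, on a piece of length at most d / 2 next to the zero nearest to [a], the
    integral of [w] is at most 1/2, so [F] would vanish on the whole piece. *)
Lemma curve_neq0 a : 0 <= a <= 1 -> F a != 0 ->
  forall x, 0 <= x <= 1 -> F x != 0.
Proof.
move=> /andP[a0 a1] Fa z /andP[z0 z1]; apply/eqP => Fz.
have [d d0 small] := relspeed_integral_small.
have [az|za] := leP a z.
  have [b [ab bz Fb Fx]] := first_zero a0 az z1 Fa Fz.
  pose p := Num.max a (b - d / 2).
  have pa : a <= p by rewrite /p le_max lexx.
  have pd : b - d / 2 <= p by rewrite /p le_max lexx orbT.
  have pb : p < b by rewrite /p gt_max ab/=; lra.
  have Fp : F p != 0 by apply: Fx; rewrite pa pb.
  suff Fp0 : F p = 0 by rewrite Fp0 eqxx in Fp.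
  have pb1 : \int[mu]_(x in `[p, b]) w x <= 2^-1 by apply: small; lra.
  apply: (vanish_near_zero _ _ _ pb1); [lra|lra|lra| |by right|lra].
  by move=> x xpb; apply: Fx; lra.
have [b [zb ba Fb Fx]] := last_zero z0 (ltW za) a1 Fa Fz.
pose q := Num.min a (b + d / 2).
have qa : q <= a by rewrite /q ge_min lexx.
have qd : q <= b + d / 2 by rewrite /q ge_min lexx orbT.
have bq : b < q by rewrite /q lt_min ba/=; lra.
have Fq : F q != 0 by apply: Fx; rewrite qa bq.
suff Fq0 : F q = 0 by rewrite Fq0 eqxx in Fq.
have bq1 : \int[mu]_(x in `[b, q]) w x <= 2^-1 by apply: small; lra.
apply: (vanish_near_zero _ _ _ bq1); [lra|lra|lra| |by left|lra].
by move=> x xpb; apply: Fx; lra.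
Qed.

End integrable_relspeed.

(** * Fenchel's inequality for the direction of a nonvanishing curve *)

Section nonvanishing.
Hypothesis Fn0 : forall x, 0 <= x <= 1 -> F x != 0.

Lemma curve_norm_lower_bound : exists2 m : R, 0 < m &
  forall x, 0 <= x <= 1 -> m <= enorm (F x).
Proof.
have [c c01 cmin] := EVT_min ler01 (curve_norm_continuous (lexx 0) (lexx 1)).
exists (enorm (F c)); first by rewrite enorm_gt0 Fn0// -in_itv.
by move=> x x01; apply: cmin; rewrite in_itv.
Qed.

Lemma integrable_relspeed : mu.-integrable `[0, 1] (EFin \o w).
Proof.
have [m m0 mP] := curve_norm_lower_bound.
apply: measurable_bounded_integrable => //.
- by rewrite /= lebesgue_measure_itv/= lte01 -EFinB ltry.
- exact: measurable_funTS measurable_relspeed.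
- exists (K / m); split; first exact: num_real.
  move=> x Kx y; rewrite /= in_itv/= => y01.
  rewrite ger0_norm ?relspeed_ge0//; apply: le_trans (ltW Kx).
  rewrite ler_pM ?invr_ge0 ?enorm_ge0//.
  by rewrite lef_pV2 ?posrE ?mP// (lt_le_trans m0)// mP.
Qed.

Let u x := normalize (F x).
Let V x := \int[mu]_(z in `[0, x]) w z.

Let u1 x : 0 <= x <= 1 -> enorm (u x) = 1.
Proof. by move=> x01; rewrite enorm_normalize// Fn0. Qed.

Let VB x y : 0 <= x -> x <= y -> y <= 1 ->
  V y - V x = \int[mu]_(z in `[x, y]) w z.
Proof.
move=> x0 xy y1; rewrite /V (Rintegral_itvD x0 xy).
  by rewrite addrAC subrr add0r.
exact: integrable_sub_itv integrable_relspeed.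
Qed.

(** With m' the smaller norm at the endpoints, the chord of directions is at most |F y - F x| / m',
    and |F| <= m' + K (y - x) in between. Replacing |F| by m' thus costs K (y - x) / m' times the
    increment of [V], which is itself at most K / m * (y - x): an error of second order. *)
Lemma chord_le m x y : 0 < m -> (forall z, 0 <= z <= 1 -> m <= enorm (F z)) ->
  0 <= x -> x <= y -> y <= 1 ->
  enorm (u x - u y) <= V y - V x + (K / m) ^+ 2 * (y - x) ^+ 2.
Proof.
move=> m0 mP x0 xy y1.
pose m' := Num.min (enorm (F x)) (enorm (F y)).
have x01 : 0 <= x <= 1 by lra.
have y01 : 0 <= y <= 1 by lra.
have mm' : m <= m' by rewrite le_min !mP.
have m'0 : 0 < m' by exact: lt_le_trans mm'.
have mx : m' <= enorm (F x) by rewrite ge_min lexx.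
have my : m' <= enorm (F y) by rewrite ge_min lexx orbT.
have yx0 : 0 <= y - x by lra.
apply: le_trans (enorm_normalizeB m'0 mx my) _.
rewrite enorm_distC ler_pdivrMr//.
apply: le_trans (curve_incr_le x0 xy y1) _.
have wK z : 0 <= z <= 1 -> w z <= K / m.
  move=> z01; rewrite ler_pM ?invr_ge0 ?enorm_ge0//.
  by rewrite lef_pV2 ?posrE ?mP// (lt_le_trans m0)// mP.
have iw : mu.-integrable `[x, y] (EFin \o w).
  exact: integrable_sub_itv integrable_relspeed.
have Fz z : x <= z <= y -> enorm (F z) <= m' + K * (y - x).
  move=> zxy; have z01 : 0 <= z <= 1 by lra.
  have l1 := curve_lipschitz x01 z01; have l2 := curve_lipschitz z01 y01.
  have h1 := lerB_enorm (F z) (F x); have h2 := lerB_enorm (F z) (F y).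
  rewrite (enorm_distC (F z) (F y)) in h2.
  have e1 : `|z - x| <= y - x by rewrite ger0_norm; lra.
  have e2 : `|y - z| <= y - x by rewrite ger0_norm; lra.
  have k1 := ler_wpM2l K0 e1; have k2 := ler_wpM2l K0 e2.
  rewrite -lerBlDr le_min; lra.
apply: (@le_trans _ _ (\int[mu]_(z in `[x, y]) ((m' + K * (y - x)) * w z))).
  apply: le_Rintegral => //.
  - exact: (bounded_integrable_itv _ _ mnf nfK).
  - exact: integrable_scaler.
  - move=> z; rewrite /= in_itv/= => zxy.
    have z01 : 0 <= z <= 1 by lra.
    have Fz0 : 0 < enorm (F z) by rewrite enorm_gt0 Fn0.
    rewrite {1}(_ : enorm (f z) = enorm (F z) * w z); last first.
      by rewrite /relspeed; field; rewrite gt_eqF.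
    by rewrite ler_wpM2r ?relspeed_ge0// Fz.
rewrite RintegralZl// -VB//.
have Vle : V y - V x <= K / m * (y - x).
  rewrite VB// -Rintegral_itv_cst//; apply: le_Rintegral => //.
  - apply: (@bounded_integrable_itv _ (fun=> K / m) `|K / m|) => //.
  - by move=> z; rewrite /= in_itv/= => zxy; apply: wK; lra.
have V0 : 0 <= V y - V x by rewrite VB// Rintegral_ge0// => z _; exact: relspeed_ge0.
rewrite mulrDl [leRHS]mulrDl mulrC lerD2l.
have Km : K * (y - x) <= K / m * (y - x) * m'.
  rewrite mulrAC ler_wpM2r//.
  by rewrite -mulrA ler_peMr// mulrC ler_pdivlMr// mul1r.
apply: (@le_trans _ _ (K / m * (y - x) * m' * (K / m * (y - x)))).
  by apply: ler_pM => //; rewrite mulr_ge0.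
by rewrite le_eqVlt; apply/orP; left; apply/eqP; ring.
Qed.

Lemma angle_le_integral x y : 0 <= x -> x <= y -> y <= 1 ->
  angle (u x) (u y) <= V y - V x.
Proof.
have [m m0 mP] := curve_norm_lower_bound.
have B0 : 0 <= K / m by rewrite divr_ge0// ltW.
(* One (K / m)^2 comes from [chord_le], the other from the cubic error D^3 <= D^2 in passing from
   chord to angle. The step length (K / m + 1)^-1 keeps the chord D at most 1. *)
move: x y; apply: (@local_to_global R (fun x y => angle (u x) (u y)) V
    (2 * (K / m) ^+ 2) (K / m + 1)^-1).
- by rewrite invr_gt0 ltr_wpDl.
- by rewrite mulr_ge0// sqr_ge0.
- by move=> x y z x0 xy yz z1; apply: angle_triangle; apply: u1; lra.
move=> x y x0 xy y1 yxd.
have x01 : 0 <= x <= 1 by lra.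
have y01 : 0 <= y <= 1 by lra.
have yx0 : 0 <= y - x by lra.
have Dle := chord_le m0 mP x0 xy y1.
have D0 := enorm_ge0 (u x - u y).
have DB : enorm (u x - u y) <= K / m * (y - x).
  apply: le_trans (enorm_normalizeB m0 (mP _ x01) (mP _ y01)) _.
  rewrite enorm_distC mulrAC ler_wpM2r ?invr_ge0 ?(ltW m0)//.
  by have := curve_lipschitz x01 y01; rewrite ger0_norm.
have B1 : K / m * (y - x) <= 1.
  apply: (@le_trans _ _ (K / m * (K / m + 1)^-1)); first by rewrite ler_wpM2l.
  by rewrite ler_pdivrMr ?ltr_wpDl//; lra.
have D1 : enorm (u x - u y) <= 1 by exact: le_trans B1.
apply: le_trans (angle_le_chord (u1 x01) (u1 y01) D1) _.
move: (K / m) (enorm (u x - u y)) D0 DB D1 Dle B1 => B D D0 DB D1 Dle B1.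
have D2 : D ^+ 2 <= (B * (y - x)) ^+ 2 by rewrite lerXn2r ?nnegrE// (le_trans D0).
have D3 : D ^+ 3 <= D ^+ 2 by rewrite exprS ler_piMl// sqr_ge0.
move: D2; rewrite exprMn; lra.
Qed.

Hypothesis F01 : F 0 = F 1.
Hypothesis F_mean0 : forall i, \int[mu]_(z in `[0, 1]) F z 0 i = 0.

(* Fenchel's argument: a closed spherical curve of length less than 2 pi lies
   in the open hemisphere centred between two points that halve it. *)
Lemma relspeed_integral_ge_2pi : 2 * pi <= \int[mu]_(z in `[0, 1]) w z.
Proof.
have [m m0 mP] := curve_norm_lower_bound.
rewrite leNgt; apply/negP => V1.
have V0E : V 0 = 0 by rewrite /V set_itv1 Rintegral_set1.
have V10 : 0 <= V 1 by rewrite /V Rintegral_ge0// => z _; exact: relspeed_ge0.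
have cV : {within `[0, 1], continuous V}.
  exact: (parameterized_integral_continuous ler01 integrable_relspeed).
have [|t] := @IVT R V 0 1 (V 1 / 2) ler01 cV.
  rewrite V0E min_l// max_r//; apply/andP; lra.
rewrite in_itv/= => /andP[t0 t1] Vt.
pose e := u 0 + u t.
pose s := V 1 / 2.
have spi : s < pi by rewrite /s /V; lra.
have s0 : 0 <= s by rewrite /s; lra.
have k0 : 0 < 1 + cos s.
  by have := cos_lt s0 spi (lexx pi); rewrite cospi; lra.
(* The points [u 0] and [u t] halve the curve. On either half the angles of [u x] to the two add up
   to at most s = V 1 / 2; on the second half, closedness replaces [u 0] by [u 1]. *)
have ue x : 0 <= x <= 1 -> 1 + cos s <= dotp (u x) e.
  move=> x01; have /andP[x0 x1] := x01.
  have t01 : 0 <= t <= 1 by rewrite t0.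
  have z01 : 0 <= (0 : R) <= 1 by rewrite lexx ler01.
  have o01 : 0 <= (1 : R) <= 1 by rewrite lexx ler01.
  rewrite dotpDr -!cos_angle ?u1//.
  apply: sum_cos_ge; rewrite ?angle_ge0 ?u1 ?(ltW spi)//.
  have [xt|/ltW tx] := leP x t.
    have a1 := angle_le_integral (lexx 0) x0 x1.
    have a2 := angle_le_integral x0 xt t1.
    by rewrite angleC /s; lra.
  have a1 := angle_le_integral t0 tx x1.
  have a2 := angle_le_integral x0 x1 (lexx 1).
  have -> : u 0 = u 1 by rewrite /u F01.
  by rewrite [angle _ (u t)]angleC /s; lra.
have Fi i : mu.-integrable `[0, 1] (EFin \o (fun x : R => F x 0 i)).
  apply: measurable_bounded_integrable => //.
  - by rewrite /= lebesgue_measure_itv/= lte01 -EFinB ltry.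
  - exact: measurable_funTS (mF i).
  - exists (enorm (F 0) + K); split; first exact: num_real.
    move=> x Kx y; rewrite /= in_itv/= => y01.
    apply: le_trans (le_coord_enorm _ _) _.
    have z01 : 0 <= (0 : R) <= 1 by rewrite lexx ler01.
    have := curve_lipschitz z01 y01; have := lerB_enorm (F y) (F 0).
    move: y01 => /andP[y0 y1].
    rewrite subr0 ger0_norm// => h1 h2.
    have : K * y <= K * 1 by rewrite ler_wpM2l.
    by lra.
have int0 : \int[mu]_(x in `[0, 1]) dotp (F x) e = 0.
  rewrite (@Rintegral_dotp _ _ _ _ 0)//.
    by apply: big1 => i _; rewrite mxE mul0r.
  by move=> i; rewrite mxE F_mean0.
(* Every [F x] would lie in the open hemisphere around [e], with a product bounded below, while the
   integral of [F] is zero. *)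
have : m * (1 + cos s) <= \int[mu]_(x in `[0, 1]) dotp (F x) e.
  rewrite -[leLHS]mulr1 -[X in _ * X](subr0 1) -Rintegral_itv_cst ?ler01//.
  apply: le_Rintegral => //.
  - by apply: (@bounded_integrable_itv _ (fun=> m * (1 + cos s)) `|m * (1 + cos s)|).
  - rewrite [X in EFin \o X](_ : _ = fun x => \sum_i F x 0 i * e 0 i)//.
    rewrite (_ : _ \o _ = fun x => (\sum_i (F x 0 i * e 0 i)%:E)%E); last first.
      by apply/funext => x; rewrite /= sumEFin.
    apply: integrable_sum => // i _.
    rewrite (_ : (fun _ => _) = EFin \o (fun x => e 0 i * F x 0 i)); last first.
      by apply/funext => x; rewrite /= mulrC.
    exact: integrable_scaler.
  - move=> x; rewrite /= in_itv/= => x01.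
    have Fx0 : 0 < enorm (F x) by rewrite enorm_gt0 Fn0.
    have -> : F x = enorm (F x) *: u x.
      by rewrite /u /normalize scalerA mulfV ?scale1r// gt_eqF.
    by rewrite dotpZl ler_pM ?(ltW m0) ?(ltW k0) ?mP ?ue.
by rewrite int0 leNgt mulr_gt0.
Qed.

End nonvanishing.
End mean_zero_curve.

(** * Chords of a closed curve *)

Section signed_shift.
Variable R : realType.
Notation mu := (@lebesgue_measure R).

Lemma integral_itv_shift h a b (f : R -> \bar R) : measurable_fun setT f ->
  (\int[mu]_(x in `[a, b]) f (x + h)%R =
   \int[mu]_(x in `[(a + h)%R, (b + h)%R]) f x)%E.
Proof.
move=> mf; rewrite integralE [RHS]integralE; congr (_ - _)%E.
transitivity (\int[mu]_(x in `[a, b]) (funepos f) (x + h)%R)%E.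
    by apply: eq_integral => x _; rewrite !funeposE.
  apply: ge0_integral_itv_shift => //; exact: measurable_funepos.
transitivity (\int[mu]_(x in `[a, b]) (funeneg f) (x + h)%R)%E.
    by apply: eq_integral => x _; rewrite !funenegE.
  apply: ge0_integral_itv_shift => //; exact: measurable_funeneg.
Qed.

Lemma periodic_integral h (f : R -> \bar R) : 0 <= h <= 1 ->
  measurable_fun setT f -> (forall x, f (x + 1)%R = f x) ->
  (\int[mu]_(x in `[0%R, 1%R]) f (x + h)%R = \int[mu]_(x in `[0%R, 1%R]) f x)%E.
Proof.
move=> h01 mf per; rewrite integralE [RHS]integralE; congr (_ - _)%E.
transitivity (\int[mu]_(x in `[0%R, 1%R]) (funepos f) (x + h)%R)%E.
    by apply: eq_integral => x _; rewrite !funeposE.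
  apply: ge0_periodic_integral => //; first exact: measurable_funepos.
  by move=> x; rewrite !funeposE per.
transitivity (\int[mu]_(x in `[0%R, 1%R]) (funeneg f) (x + h)%R)%E.
    by apply: eq_integral => x _; rewrite !funenegE.
  apply: ge0_periodic_integral => //; first exact: measurable_funeneg.
by move=> x; rewrite !funenegE per.
Qed.

End signed_shift.

Section mean_zero_energy.
Variables (R : realType) (n : nat) (F f : R -> 'rV[R]_n) (K : R).
Notation mu := (@lebesgue_measure R).

Lemma relspeed_sqr_integral_ge : measurable_vec F -> measurable_vec f ->
  (forall x, enorm (f x) <= K) ->
  (forall (x y : R) i, 0 <= x -> x <= y -> y <= 1 ->
    F y 0 i - F x 0 i = \int[mu]_(z in `[x, y]) f z 0 i) ->
  F 0 = F 1 -> (forall i, \int[mu]_(z in `[0, 1]) F z 0 i = 0) ->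
  (exists2 a, 0 <= a <= 1 & F a != 0) ->
  ((4 * pi ^+ 2)%:E <= \int[mu]_(x in `[0%R, 1%R]) (relspeed F f x ^+ 2)%:E)%E.
Proof.
move=> mF mf fK FE F01 Fm [a a01 Fa].
have mw := measurable_relspeed mF mf.
(* An infinite integral leaves nothing to prove; a finite one makes [relspeed] integrable, which
   excludes zeros of [F]. *)
have [woo|woo] := ltP (\int[mu]_(x in `[0%R, 1%R]) (relspeed F f x ^+ 2)%:E)%E +oo%E;
  last by rewrite (le_trans _ woo)// leey.
have mw2 : measurable_fun setT (fun x => relspeed F f x ^+ 2).
  exact: measurable_funX.
have iw2 : mu.-integrable `[0, 1] (EFin \o (fun x => relspeed F f x ^+ 2)).
  apply/integrableP; split.
    by apply/measurable_EFinP; exact: measurable_funTS.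
  under eq_integral do rewrite /= ger0_norm ?sqr_ge0//.
  exact: woo.
have i1 (r : R) : mu.-integrable `[0, 1] (EFin \o (fun=> r)).
  exact: (@bounded_integrable_itv _ (fun=> r) `|r|).
have iq : mu.-integrable `[0, 1]
    (EFin \o (fun x => (4 * pi)^-1 * relspeed F f x ^+ 2 + pi)).
  by apply: integrable_addr => //; exact: integrable_scaler.
have pi0 := pi_gt0 R.
(* Cauchy-Schwarz in linear form: the weights give equality at relative speed 2 pi, that of a great
   circle run through uniformly. *)
have amgm x : relspeed F f x <= (4 * pi)^-1 * relspeed F f x ^+ 2 + pi.
  have pin0 : pi != 0 :> R by rewrite gt_eqF.
  have e (r p : R) : p != 0 ->
      (4 * p)^-1 * r ^+ 2 + p - r = (4 * p)^-1 * (r - 2 * p) ^+ 2.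
    by move=> p0; field.
  by rewrite -subr_ge0 e// mulr_ge0 ?sqr_ge0// invr_ge0 mulr_ge0// ltW.
have iw : mu.-integrable `[0, 1] (EFin \o relspeed F f).
  apply: le_integrable iq => //.
    by apply/measurable_EFinP; exact: measurable_funTS.
  move=> x _ /=; rewrite lee_fin ger0_norm ?relspeed_ge0// ger0_norm//.
  exact: le_trans (relspeed_ge0 _ _ _) (amgm x).
have Fn0 := curve_neq0 mf fK FE iw a01 Fa.
have := relspeed_integral_ge_2pi mF mf fK FE Fn0 F01 Fm.
have : \int[mu]_(x in `[0, 1]) relspeed F f x <=
    (4 * pi)^-1 * (\int[mu]_(x in `[0, 1]) (relspeed F f x ^+ 2)) + pi.
  rewrite -RintegralZl//.
  have piE : \int[mu]_(x in `[0, 1]) pi = pi :> R.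
    by rewrite Rintegral_itv_cst// subr0 mulr1.
  rewrite -[X in _ <= _ + X]piE.
  rewrite -RintegralD//; last exact: integrable_scaler.
  exact: le_Rintegral.
rewrite -[in X in _ -> X](@fineK _ (\int[mu]_(x in _) _)%E); last first.
  exact: (integrable_fin_num _ iw2).
rewrite lee_fin -/(Rintegral _ _ _) => h1 h2.
have : 2 * pi <= (4 * pi)^-1 * (\int[mu]_(x in `[0, 1]) (relspeed F f x ^+ 2)) + pi.
  exact: le_trans h2 h1.
rewrite -lerBlDr [_^-1 * _]mulrC ler_pdivlMr ?mulr_gt0// => h.
by apply: le_trans h; rewrite le_eqVlt; apply/orP; left; apply/eqP; ring.
Qed.

End mean_zero_energy.

Section closed_curve.
Variables (R : realType) (n : nat) (G T : R -> 'rV[R]_n) (K : R).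
Notation mu := (@lebesgue_measure R).
Hypotheses (mG : measurable_vec G) (mT : measurable_vec T).
Hypotheses (Gper : forall x, G (x + 1) = G x) (Tper : forall x, T (x + 1) = T x).
Hypothesis TK : forall x, enorm (T x) <= K.
Hypothesis GE : forall (x y : R) i, 0 <= x -> x <= y -> y <= 1 ->
  G y 0 i - G x 0 i = \int[mu]_(z in `[x, y]) T z 0 i.
Hypothesis Gn : exists2 a, 0 <= a <= 1 & G a != G 0.

Let K0 : 0 <= K. Proof. exact: le_trans (enorm_ge0 _) (TK 0). Qed.

Let TiK i x : `|T x 0 i| <= K.
Proof. exact: le_trans (le_coord_enorm _ _) (TK x). Qed.

Let intT i a b : mu.-integrable `[a, b] (EFin \o (fun x : R => T x 0 i)).
Proof. exact: (bounded_integrable_itv _ _ (mT i) (TiK i)). Qed.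

Let T_shift i a b h : \int[mu]_(z in `[a, b]) T (z + h) 0 i =
  \int[mu]_(z in `[(a + h), (b + h)]) T z 0 i.
Proof.
congr fine; apply: (@integral_itv_shift _ h a b (fun x => (T x 0 i)%:E)).
by apply/measurable_EFinP; exact: mT.
Qed.

(** The shifted arguments x + h range over [0, 2], so the relation between [G] and [T] is carried
    through a second period. *)
Lemma closed_curve_incr x y i : 0 <= x -> x <= y -> y <= 2 ->
  G y 0 i - G x 0 i = \int[mu]_(z in `[x, y]) T z 0 i.
Proof.
move=> x0 xy y2.
have GE1 u v : 1 <= u -> u <= v -> v <= 2 ->
    G v 0 i - G u 0 i = \int[mu]_(z in `[u, v]) T z 0 i.
  move=> u1 uv v2.
  have -> : G v = G (v - 1) by rewrite -[in LHS](subrK 1 v) Gper.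
  have -> : G u = G (u - 1) by rewrite -[in LHS](subrK 1 u) Gper.
  rewrite GE; [|lra|lra|lra].
  have := T_shift i (u - 1) (v - 1) 1; rewrite !subrK => <-.
  by under [in RHS]eq_Rintegral do rewrite Tper.
have [y1|/ltW y1] := leP y 1; first exact: GE.
have [x1|/ltW x1] := leP 1 x; first exact: GE1.
rewrite (@Rintegral_itvD _ _ x 1 y x1 y1); last exact: intT.
by rewrite -GE// -GE1//; ring.
Qed.

Lemma closed_curve_lipschitz x y : 0 <= x -> x <= y -> y <= 2 ->
  enorm (G y - G x) <= K * (y - x).
Proof.
move=> x0 xy y2.
apply: (@le_trans _ _ (\int[mu]_(z in `[x, y]) enorm (T z))).
  apply: (enorm_Rintegral_le mT TK) => i.
  by rewrite !mxE closed_curve_incr.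
apply: le_trans (ler_norm _) (Rintegral_itv_le xy _ _).
  exact: measurable_enorm.
by move=> z; rewrite ger0_norm ?enorm_ge0.
Qed.

Let chord h x := G (x + h) - G x.

Lemma chord_energy_ge h : 0 <= h <= 1 ->
  (exists2 a, 0 <= a <= 1 & chord h a != 0) ->
  ((4 * pi ^+ 2)%:E <= \int[mu]_(x in `[0%R, 1%R])
    (enorm (T (x + h) - T x) ^+ 2 / enorm (G (x + h) - G x) ^+ 2)%:E)%E.
Proof.
move=> h01 Gh.
have mGh : measurable_vec (fun x : R => G (x + h)).
  by apply: (measurable_vec_comp (f := G)) => //; exact: measurable_shift.
have mTh : measurable_vec (fun x : R => T (x + h)).
  by apply: (measurable_vec_comp (f := T)) => //; exact: measurable_shift.
have := @relspeed_sqr_integral_ge R n (chord h) (fun x => T (x + h) - T x) (K + K).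
rewrite /relspeed; under eq_integral do rewrite expr_div_n.
apply => //.
- exact: measurable_vecB.
- exact: measurable_vecB.
- by move=> x; rewrite (le_trans (enormB _ _))// lerD.
- move=> x y i x0 xy y1; rewrite /chord !mxE.
  under eq_Rintegral do rewrite !mxE.
  rewrite RintegralB//; last first.
    apply: (bounded_integrable_itv (K := K)); first exact: mTh.
    by move=> z; exact: TiK.
  rewrite T_shift -!closed_curve_incr; [ring|lra..].
- have G1 : G 1 = G 0 by rewrite -[X in G X]add0r Gper.
  by rewrite /chord add0r (addrC 1) Gper G1.
- move=> i; rewrite /chord.
  under eq_Rintegral do rewrite !mxE.
  have Gb z : 0 <= z <= 2 -> `|G z 0 i| <= enorm (G 0) + 2 * K.
    move=> /andP[z0 z2]; apply: le_trans (le_coord_enorm _ _) _.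
    have := closed_curve_lipschitz (lexx 0) z0 z2.
    have := lerB_enorm (G z) (G 0); rewrite subr0.
    have : K * z <= K * 2 by rewrite ler_wpM2l.
    lra.
  have bnd (g : R -> 'rV[R]_n) : measurable_vec g ->
      (forall z, 0 <= z <= 1 -> `|g z 0 i| <= enorm (G 0) + 2 * K) ->
      mu.-integrable `[0, 1] (EFin \o (fun x : R => g x 0 i)).
    move=> mg gb; apply: measurable_bounded_integrable => //.
    + by rewrite /= lebesgue_measure_itv/= lte01 -EFinB ltry.
    + exact: measurable_funTS (mg i).
    + exists (enorm (G 0) + 2 * K); split; first exact: num_real.
      move=> x Kx y; rewrite /= in_itv/= => y01.
      exact: le_trans (gb _ y01) (ltW Kx).
  rewrite (@RintegralB _ _ _ mu _ (fun x : R => G (x + h) 0 i))//; last 2 first.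
  + by apply: (bnd (fun x => G (x + h))) => // z z01; apply: Gb; lra.
  + by apply: bnd => // z z01; apply: Gb; lra.
  apply/eqP; rewrite subr_eq0; apply/eqP; congr fine.
  apply: (@periodic_integral _ h (fun x => (G x 0 i)%:E)) => //.
    by apply/measurable_EFinP; exact: mG.
  by move=> x; rewrite Gper.
Qed.

(* The shifts leaving the curve invariant are discrete since the curve is not
   constant. *)
Lemma countable_invariant_shifts :
  countable [set h | 0 <= h <= 1 /\ forall x, 0 <= x <= 1 -> chord h x = 0].
Proof.
have [a /andP[a0 a1] Ga] := Gn.
pose eta := enorm (G a - G 0).
have eta0 : 0 < eta by rewrite enorm_gt0 subr_eq0.
pose del := eta / (K + 1).
have del0 : 0 < del by rewrite divr_gt0// ltr_wpDl.
set P := [set _ | _].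
(* The difference t of two invariant shifts is a period of [G], so [a] lies within t to the right of
   a multiple of t at which [G] equals [G 0]. The Lipschitz bound then gives eta <= K t. *)
have gap h h' : P h -> P h' -> h < h' -> del <= h' - h.
  move=> [h01 hP] [h01' hP'] hh.
  pose t := h' - h; have t0 : 0 < t by rewrite subr_gt0.
  have per y : 0 <= y <= 1 -> G (y + t) = G y.
    have aux x : 0 <= x <= 1 -> G (x + h + t) = G (x + h).
      move=> x01; have /eqP := hP _ x01; have /eqP := hP' _ x01.
      rewrite !subr_eq0 => /eqP e1 /eqP ->.
      by rewrite /t (_ : x + h + (h' - h) = x + h')//; ring.
    move=> y01; have [hy|yh] := leP h y.
      by rewrite -[in RHS](subrK h y) -aux ?subrK//; lra.
    rewrite -Gper -[in RHS]Gper (_ : y + t + 1 = y + 1 - h + h + t); last by ring.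
    by rewrite aux; [congr G; ring|lra].
  pose k := Num.truncn (a / t).
  have at0 : 0 <= a / t by rewrite divr_ge0// ltW.
  have ka : k%:R * t <= a by rewrite -ler_pdivlMr// truncn_le.
  have ak : a < k.+1%:R * t by rewrite -ltr_pdivrMr// truncnS_gt.
  have Gk j : (j <= k)%N -> G (j%:R * t) = G 0.
    elim: j => [|j IH] jk; first by rewrite mul0r.
    have jt : j.+1%:R * t <= k%:R * t by rewrite ler_wpM2r ?ler_nat// ltW.
    have e : j.+1%:R * t = j%:R * t + t by rewrite -natr1; ring.
    have j0 : 0 <= j%:R * t by rewrite mulr_ge0// ltW.
    by rewrite e per ?IH ?(ltnW jk)//; lra.
  have kt0 : 0 <= k%:R * t by rewrite mulr_ge0// ltW.
  have := @closed_curve_lipschitz (k%:R * t) a kt0 ka.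
  rewrite Gk// -/eta => lip.
  have {}lip : eta <= K * (a - k%:R * t) by apply: lip; lra.
  have kk : k.+1%:R * t = k%:R * t + t by rewrite -natr1; ring.
  rewrite -/t ler_pdivrMr ?ltr_wpDl//.
  have : K * (a - k%:R * t) <= K * t by rewrite ler_wpM2l//; lra.
  lra.
(* Two invariant shifts in the same cell of length [del] are closer than the gap, hence equal. *)
apply/countable_injP; exists (fun h => Num.truncn (h / del)).
move=> h h'; rewrite !inE => Ph Ph' e.
have tr x : P x -> (Num.truncn (x / del))%:R * del <= x /\
    x < (Num.truncn (x / del)).+1%:R * del.
  move=> [/andP[x0 _] _]; rewrite -ler_pdivlMr// -ltr_pdivrMr//.
  by rewrite truncn_le truncnS_gt; split => //; rewrite divr_ge0// ltW.
have [l1 u1] := tr _ Ph; have [l2 u2] := tr _ Ph'.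
have kk (k : nat) : k.+1%:R * del = k%:R * del + del by rewrite -natr1; ring.
move: l2 u2; rewrite -e => l2 u2.
rewrite kk in u1; rewrite kk in u2.
have [hh|hh|//] := ltgtP h h'.
- by have := gap _ _ Ph Ph' hh; lra.
- by have := gap _ _ Ph' Ph hh; lra.
Qed.

(** Periodicity allows the substitution u = h + v in the inner integral, and Tonelli moves h
    outside. The bound for each chord is then integrated over h in [0, 1], leaving out the null set
    of shifts whose chord vanishes identically. *)
Lemma closed_curve_energy_ge : ((4 * pi ^+ 2)%:E <=
  \int[mu]_(v in `[0%R, 1%R]) \int[mu]_(u in `[0%R, 1%R])
    (enorm (T u - T v) ^+ 2 / enorm (G u - G v) ^+ 2)%:E)%E.
Proof.
pose k (z : measurableTypeR R * measurableTypeR R) : R :=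
  enorm (T z.1 - T z.2) ^+ 2 / enorm (G z.1 - G z.2) ^+ 2.
have k0 z : 0 <= k z by rewrite divr_ge0// sqr_ge0.
have mk : measurable_fun setT k.
  have m1 (g : R -> 'rV[R]_n) : measurable_vec g ->
      measurable_vec (fun z : measurableTypeR R * measurableTypeR R => g z.1 - g z.2).
    move=> mg; apply: measurable_vecB.
      exact: (measurable_vec_comp measurable_fst).
    exact: (measurable_vec_comp measurable_snd).
  apply: measurable_funM.
    by apply: measurable_funX; apply: measurable_enorm; exact: m1.
  apply: (measurableT_comp (@measurable_inv R)).
  by apply: measurable_funX; apply: measurable_enorm; exact: m1.
pose k' (z : measurableTypeR R * measurableTypeR R) : \bar R :=
  (k (z.1 + z.2, z.2))%:E.
have mk' : measurable_fun setT k'.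
  apply/measurable_EFinP; apply: (measurableT_comp mk).
  apply: measurable_fun_pair => //.
  by apply: measurable_funD; [exact: measurable_fst|exact: measurable_snd].
have k'0 z : (0 <= k' z)%E by rewrite lee_fin.
have -> : (\int[mu]_(v in `[0%R, 1%R]) \int[mu]_(u in `[0%R, 1%R])
    (enorm (T u - T v) ^+ 2 / enorm (G u - G v) ^+ 2)%:E =
    \int[mu]_(v in `[0%R, 1%R]) \int[mu]_(h in `[0%R, 1%R]) k' (h, v))%E.
  apply: eq_integral => v; rewrite inE/= in_itv/= => v01.
  rewrite -(@ge0_periodic_integral _ v)//.
  - apply/measurable_EFinP.
    exact: (measurableT_comp mk (pair2_measurable (v : measurableTypeR R))).
  - by move=> x; rewrite lee_fin; exact: (k0 (x, v)).
  - by move=> x; rewrite Tper Gper.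
rewrite -(tonelli_itv 0 1 0 1 mk' k'0).2.
have -> : ((4 * pi ^+ 2)%:E = \int[mu]_(h in `[0%R, 1%R]) (4 * pi ^+ 2)%:E)%E.
  rewrite integral_cst//= lebesgue_measure_itv/= lte01 -EFinB subr0 mule1//.
apply: ae_ge0_le_integral => //.
- by move=> x _; rewrite lee_fin mulr_ge0// sqr_ge0.
- by move=> x _; apply: integral_ge0.
- exact: measurable_funTS (measurable_integral_itv 0 1 mk' k'0).
set P := [set h | 0 <= h <= 1 /\ forall x, 0 <= x <= 1 -> chord h x = 0].
exists P; split.
- exact: countable_measurable countable_invariant_shifts.
- exact: countable_lebesgue_measure0 countable_invariant_shifts.
move=> h /= /not_implyP[]; rewrite in_itv/= => h01 hle; split => // x x01.
apply/eqP; apply: contrapT => /negP xh; apply: hle.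
apply: le_trans (chord_energy_ge h01 _) _; first by exists x.
rewrite le_eqVlt; apply/orP; left; apply/eqP.
by apply: eq_integral => y _; rewrite /k' /k /= (addrC h y).
Qed.

End closed_curve.

(** * Arclength reparametrization *)

Section density_measure.
Variables (R : realType) (d : R -> R).
Notation mu := (@lebesgue_measure R).
Hypotheses (d0 : forall x, 0 <= d x) (di : mu.-integrable setT (EFin \o d)).

(* The proofs are parameters so that the measure structure can be inferred. *)
Definition density_measure of (forall x, 0 <= d x) &
  mu.-integrable setT (EFin \o d) := fun A : set (measurableTypeR R) =>
  (\int[mu]_(x in A) (d x)%:E)%E.

Local Notation nu := (density_measure d0 di).

Let md : measurable_fun setT (EFin \o d). Proof. exact: measurable_int di. Qed.

Let nu0 : nu set0 = 0%E. Proof. exact: integral_set0. Qed.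

Let nu_ge0 A : (0 <= nu A)%E.
Proof. by apply: integral_ge0 => x _; rewrite lee_fin. Qed.

Let nu_sigma_additive : semi_sigma_additive nu.
Proof. by apply: semi_sigma_additive_nng_induced => // x; rewrite lee_fin. Qed.

HB.instance Definition _ := isMeasure.Build _ _ _ nu
  nu0 nu_ge0 nu_sigma_additive.

Let nu_fin : fin_num_fun nu.
Proof.
move=> A mA; apply: integrable_fin_num => //.
exact: integrableS di.
Qed.

HB.instance Definition _ := @Measure_isFinite.Build _ _ _ nu nu_fin.

Let nu_dom : nu `<< mu.
Proof.
apply/null_content_dominatesP => A mA muA0.
have := @integral_abs_eq0 _ _ _ mu A (EFin \o d) mA _ muA0.
rewrite /density_measure => <-; last exact: measurable_funTS.
by apply: eq_integral => x _; rewrite /= ger0_norm.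
Qed.

(** The formula holds for the Radon-Nikodym derivative of [nu], which equals [d] almost everywhere
    because both have the same integral over every measurable set. *)
Lemma ge0_integral_density (k : R -> \bar R) : measurable_fun setT k ->
  (forall x, 0 <= k x)%E ->
  (\int[nu]_x k x = \int[mu]_x (k x * (d x)%:E))%E.
Proof.
move=> mk k0.
rewrite -(Radon_Nikodym_SigmaFinite.change_of_variables nu_dom)//.
have iRN := Radon_Nikodym_SigmaFinite.f_integrable nu_dom.
apply: ge0_ae_eq_integral => //.
- by apply: emeasurable_funM => //; exact: measurable_int iRN.
- exact: emeasurable_funM.
- move=> x _; rewrite mule_ge0//.
  exact: (Radon_Nikodym_SigmaFinite.f_ge0 nu_dom).
- by move=> x _; rewrite mule_ge0// lee_fin.
- apply: ae_eqe_mul2l; apply: integral_ae_eq => // E _ mE.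
  by rewrite -Radon_Nikodym_SigmaFinite.f_integral.
Qed.

End density_measure.

(** * The inverse of the normalized arclength and its change of variables *)

Section reparametrization.
Variables (R : realType) (l : R -> R) (c : R).
Notation mu := (@lebesgue_measure R).
Hypotheses (l0 : forall x, 0 <= l x) (li : mu.-integrable `[0, 1] (EFin \o l)).
Hypotheses (c0 : 0 < c) (lc : {ae mu, forall x, c <= l x}).
Hypothesis ml : measurable_fun setT l.

Let L := \int[mu]_(x in `[0, 1]) l x.
Let sigma x := L^-1 * \int[mu]_(z in `[0, x]) l z.

Let li_sub x y : 0 <= x -> y <= 1 -> mu.-integrable `[x, y] (EFin \o l).
Proof. by move=> x0 y1; exact: integrable_sub_itv li. Qed.

Lemma speed_integral_ge x y : 0 <= x -> x <= y -> y <= 1 ->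
  c * (y - x) <= \int[mu]_(z in `[x, y]) l z.
Proof.
move=> x0 xy y1; rewrite -Rintegral_itv_cst// /Rintegral fine_le//.
- apply: (integrable_fin_num (mu := mu)) => //.
  exact: (@bounded_integrable_itv _ (fun=> c) `|c|).
- by apply: (integrable_fin_num (mu := mu)) => //; exact: li_sub.
- apply: ae_ge0_le_integral => //.
  + by move=> z _; rewrite lee_fin ltW.
  + by move=> z _; rewrite lee_fin.
  + by apply/measurable_EFinP; exact: measurable_funTS.
  + by case: lc => N [mN N0 sN]; exists N; split => // z /= h; apply: sN => h';
      apply: h; rewrite lee_fin.
Qed.

Let L0 : 0 < L.
Proof.
apply: lt_le_trans (speed_integral_ge (lexx 0) ler01 (lexx 1)).
by rewrite subr0 mulr1.
Qed.

Let sigmaB x y : 0 <= x -> x <= y -> y <= 1 ->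
  sigma y - sigma x = L^-1 * \int[mu]_(z in `[x, y]) l z.
Proof.
move=> x0 xy y1; rewrite /sigma (@Rintegral_itvD _ _ 0 x y)//; last exact: li_sub.
by ring.
Qed.

Let sigma_lt x y : 0 <= x -> x < y -> y <= 1 -> sigma x < sigma y.
Proof.
move=> x0 xy y1; rewrite -subr_gt0 sigmaB ?(ltW xy)// mulr_gt0 ?invr_gt0//.
apply: lt_le_trans (speed_integral_ge x0 (ltW xy) y1).
by rewrite mulr_gt0// subr_gt0.
Qed.

Let sigma0 : sigma 0 = 0.
Proof. by rewrite /sigma set_itv1 Rintegral_set1 mulr0. Qed.

Let sigma1 : sigma 1 = 1.
Proof. by rewrite /sigma mulVf// gt_eqF. Qed.

Let sigma_continuous : {within `[0, 1], continuous sigma}.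
Proof.
have := parameterized_integral_continuous ler01 li.
move=> /subspace_continuousP h; apply/subspace_continuousP => x x01.
by apply: cvgM; [exact: cvg_cst|exact: h].
Qed.

(** Clamping makes the inverse of [sigma] total and nondecreasing on the whole line, so that its
    measurability follows from monotonicity. *)
Let clamp (u : R) := Num.max 0 (Num.min 1 u).

Let clamp01 u : 0 <= clamp u <= 1.
Proof. by rewrite /clamp le_max lexx/= ge_max ler01 ge_min lexx. Qed.

Let clampE u : 0 <= u <= 1 -> clamp u = u.
Proof. by move=> /andP[u0 u1]; rewrite /clamp min_r// max_r. Qed.

Let rho_ex u : exists x, (0 <= x <= 1) && (sigma x == clamp u).
Proof.
have [|x x01 xE] := @IVT R sigma 0 1 (clamp u) ler01 sigma_continuous.
  by rewrite sigma0 sigma1 min_l// max_r.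
by exists x; move: x01; rewrite in_itv/= => ->; rewrite xE eqxx.
Qed.

Definition arclength_inverse u := xchoose (rho_ex u).
Local Notation rho := arclength_inverse.

Lemma arclength_inverse_itv u : 0 <= rho u <= 1.
Proof. by have /andP[] := xchooseP (rho_ex u). Qed.

Let sigma_rho u : sigma (rho u) = clamp u.
Proof. by have /andP[_ /eqP] := xchooseP (rho_ex u). Qed.

Let sigma_le x y : 0 <= x <= 1 -> 0 <= y <= 1 -> (sigma x <= sigma y) = (x <= y).
Proof.
move=> /andP[x0 x1] /andP[y0 y1]; have [xy|yx|->] := ltgtP x y.
- by rewrite ltW// sigma_lt.
- by apply/negbTE; rewrite -ltNge sigma_lt.
- by rewrite lexx.
Qed.

Lemma le_arclength_inverse u v : u <= v -> rho u <= rho v.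
Proof.
move=> uv.
rewrite -(sigma_le (arclength_inverse_itv u) (arclength_inverse_itv v)) !sigma_rho.
have h : Num.min 1 u <= Num.min 1 v by rewrite le_min !ge_min lexx uv orbT.
by rewrite /clamp ge_max !le_max lexx h orbT.
Qed.

Lemma measurable_arclength_inverse : measurable_fun setT rho.
Proof. by apply: nondecreasing_measurable => // u v; exact: le_arclength_inverse. Qed.

Let rho_le x u : 0 <= x <= 1 -> 0 <= u <= 1 -> (x <= rho u) = (sigma x <= u).
Proof.
move=> x01 u01.
by rewrite -sigma_le ?arclength_inverse_itv// sigma_rho clampE.
Qed.

Lemma arclength_inverse0 : rho 0 = 0.
Proof.
apply/eqP; rewrite eq_le -sigma_le ?arclength_inverse_itv ?lexx ?ler01//.
rewrite sigma_rho clampE ?lexx ?ler01// sigma0 lexx/=.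
by have /andP[] := arclength_inverse_itv 0.
Qed.

Lemma arclength_inverse1 : rho 1 = 1.
Proof.
apply/eqP; rewrite eq_le rho_le ?lexx ?ler01// sigma1 lexx andbT.
by have /andP[] := arclength_inverse_itv 1.
Qed.

Lemma arclength_inverse_mono u v : 0 <= u <= 1 -> 0 <= v <= 1 ->
  (rho u <= rho v) = (u <= v).
Proof.
move=> u01 v01; rewrite -sigma_le ?arclength_inverse_itv//.
by rewrite !sigma_rho !clampE.
Qed.

Lemma arclength_inverse_surj x : 0 <= x <= 1 ->
  exists2 u, 0 <= u <= 1 & rho u = x.
Proof.
move=> x01; have u01 : 0 <= sigma x <= 1.
  by rewrite -sigma0 -sigma1 !sigma_le ?lexx ?ler01.
have e : sigma (rho (sigma x)) = sigma x by rewrite sigma_rho clampE.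
exists (sigma x) => //; apply/eqP; rewrite eq_le.
rewrite -(sigma_le (arclength_inverse_itv (sigma x)) x01).
by rewrite -(sigma_le x01 (arclength_inverse_itv (sigma x))) e lexx.
Qed.

Let i01 : mu.-integrable setT (EFin \o \1_(`[0, 1] : set R)).
Proof.
apply/integrableP; split; first by apply/measurable_EFinP; exact: measurable_indic.
under eq_integral do rewrite /= ger0_norm//.
by rewrite integral_indic//= setIT lebesgue_measure_itv/= lte01 -EFinB ltry.
Qed.

Let dens x := L^-1 * (l \_ `[0, 1]) x.

Let dens0 x : 0 <= dens x.
Proof. by rewrite mulr_ge0 ?invr_ge0 ?(ltW L0)// patchE; case: ifP. Qed.

Let idens : mu.-integrable setT (EFin \o dens).
Proof.
apply: integrable_scaler => //.
by rewrite -restrict_EFin; apply/integrable_restrict => //; rewrite setTI.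
Qed.

Let ind0 x : 0 <= (\1_(`[0, 1] : set R) x : R).
Proof. by rewrite indicE. Qed.

(** The substitution needs no derivative of [rho]: two measures are compared on the rays [x, +oo[,
    which generate the Borel sets and are stable under intersection. For x in [0, 1] the preimage of
    the ray in [0, 1] is [sigma x, 1], of length 1 - sigma x, and this is the integral of l / L over
    [x, 1]. *)
Lemma pushforward_arclength_inverse A : measurable A ->
  pushforward (density_measure ind0 i01) (rho : R -> measurableTypeR R) A =
  density_measure dens0 idens A.
Proof.
move=> mA.
have mrho : measurable_fun setT (rho : R -> measurableTypeR R).
  exact: measurable_arclength_inverse.
pose m : {measure set (measurableTypeR R) -> \bar R} :=
  measure_function_pushforward__canonical__measure_function_Measure
    (density_measure ind0 i01) mrho.
have mpre B : measurable B -> measurable (rho @^-1` B).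
  by move=> mB; rewrite -[X in measurable X]setTI; exact: measurable_arclength_inverse.
have mE B : measurable B -> m B = mu ((rho @^-1` B) `&` `[0, 1]).
  move=> mB; rewrite /m /= /pushforward /density_measure integral_indic 1?setIC//.
  exact: mpre.
pose m' : {measure set (measurableTypeR R) -> \bar R} := density_measure dens0 idens.
rewrite -[LHS]/(m A) -[RHS]/(m' A).
apply: (@measure_unique _ R (measurableTypeR R) (@RGenCInfty.G R)
  (fun k => `[- k%:R, +oo[%classic) _ _ _ _ m m') => //.
- exact: RGenCInfty.measurableE.
- move=> _ _ [x ->] [y ->]; exists (Num.max x y); apply/seteqP; split => z /=.
    by rewrite !in_itv/= !andbT ge_max => -[-> ->].
  by rewrite !in_itv/= !andbT ge_max => /andP[].
- by move=> k; exists (- k%:R).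
- apply/seteqP; split => // x _; exists (Num.truncn `|x|).+1 => //=.
  rewrite in_itv/= andbT lerNl; apply: le_trans (ltW (truncnS_gt _)).
  by rewrite -normrN ler_norm.
- move=> _ [x ->]; rewrite mE// /m' /= /density_measure /dens.
  have -> : (\int[mu]_(z in `[x, +oo[) (L^-1 * (l \_ `[0, 1]) z)%:E =
      \int[mu]_(z in `[x, +oo[ `&` `[0%R, 1%R]) (L^-1 * l z)%:E)%E.
    rewrite integral_mkcondr; apply: eq_integral => z _.
    by rewrite !patchE; case: ifP => // _; rewrite mulr0.
  have [x1|x1] := ltP 1 x.
    rewrite [X in mu X](_ : _ = set0).
      rewrite [X in integral _ X](_ : _ = set0) ?integral_set0 ?measure0//.
      apply/seteqP; split => // z /= []; rewrite !in_itv/= andbT => xz /andP[_].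
      by move=> /(le_trans xz); rewrite leNgt x1.
    apply/seteqP; split => // z /= []; rewrite in_itv/= andbT => xz _.
    have /andP[_] := arclength_inverse_itv z.
    by move=> /(le_trans xz); rewrite leNgt x1.
  pose y := Num.max 0 x.
  have y01 : 0 <= y <= 1 by rewrite /y le_max lexx/= ge_max ler01.
  have xy z : 0 <= z <= 1 -> (x <= z) = (y <= z).
    by move=> /andP[z0 _]; rewrite /y ge_max z0.
  have -> : `[x, +oo[ `&` `[0, 1] = `[y, 1]%classic.
    apply/seteqP; split => z /=; rewrite !in_itv/= ?andbT.
      by move=> [xz z01]; rewrite -xy// xz; case/andP: z01.
    move=> /andP[yz z1]; have z01 : 0 <= z <= 1.
      by rewrite z1 andbT (le_trans _ yz)//; case/andP: y01.
    by rewrite xy.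
  have -> : rho @^-1` `[x, +oo[ `&` `[0, 1] = `[sigma y, 1]%classic.
    have sy : 0 <= sigma y by rewrite -sigma0 sigma_le ?lexx ?ler01//; case/andP: y01.
    apply/seteqP; split => z /=; rewrite !in_itv/= ?andbT.
      move=> [xz z01]; move: xz; rewrite xy ?arclength_inverse_itv// rho_le// => ->.
      by case/andP: z01.
    move=> /andP[yz z1]; have z01 : 0 <= z <= 1.
      by rewrite z1 andbT (le_trans _ yz).
    by rewrite xy ?arclength_inverse_itv// rho_le.
  have /andP[y0 y1] := y01.
  have sy1 : sigma y <= 1 by rewrite -sigma1 sigma_le ?lexx ?ler01.
  have := sigmaB y0 y1 (lexx 1); rewrite sigma1 -RintegralZl//; last exact: li_sub.
  move=> e; rewrite -[RHS]fineK; last first.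
    apply: (integrable_fin_num (mu := mu)) => //.
    by apply: integrable_scaler => //; exact: li_sub.
  rewrite -[fine _]/(Rintegral _ _ _) -e lebesgue_measure_itv/= lte_fin.
  case: ltP => [//|h]; rewrite (le_anti (introT andP (conj h sy1))).
  by rewrite subrr.
- move=> k; rewrite mE//.
  apply: (@le_lt_trans _ _ (mu `[0, 1])).
    apply: le_measure; rewrite ?inE//.
    by apply: measurableI => //; exact: mpre.
  by rewrite lebesgue_measure_itv/= lte01 -EFinB ltry.
Qed.

Lemma ge0_integral_arclength (k : R -> \bar R) : measurable_fun setT k ->
  (forall x, 0 <= k x)%E ->
  (\int[mu]_(u in `[0%R, 1%R]) k (rho u) =
   (L^-1)%:E * \int[mu]_(x in `[0%R, 1%R]) (k x * (l x)%:E))%E.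
Proof.
move=> mk k0.
have mrho : measurable_fun setT (rho : R -> measurableTypeR R).
  exact: measurable_arclength_inverse.
pose m : {measure set (measurableTypeR R) -> \bar R} :=
  measure_function_pushforward__canonical__measure_function_Measure
    (density_measure ind0 i01) mrho.
transitivity (\int[density_measure ind0 i01]_u k (rho u))%E.
  rewrite ge0_integral_density//; last exact: (measurableT_comp mk mrho).
  rewrite [LHS]integral_mkcond; apply: eq_integral => u _.
  by rewrite patchE indicE; case: ifP; rewrite ?mule1 ?mule0.
transitivity (\int[m]_x k x)%E.
  rewrite (@ge0_integral_pushforward _ _ (measurableTypeR R) (measurableTypeR R) R
    _ mrho (density_measure ind0 i01) setT k)//.
transitivity (\int[density_measure dens0 idens]_x k x)%E.
  apply: eq_measure_integral => A mA _.
  exact: pushforward_arclength_inverse.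
rewrite ge0_integral_density//.
rewrite -ge0_integralZl//; last 3 first.
- by apply: emeasurable_funM; [exact: measurable_funTS|
    apply/measurable_EFinP; exact: measurable_funTS].
- by move=> x _; rewrite mule_ge0// lee_fin.
- by rewrite lee_fin invr_ge0 ltW.
rewrite [RHS]integral_mkcond; apply: eq_integral => x _.
rewrite /dens !patchE; case: ifP => _; last by rewrite mulr0 mule0.
by rewrite EFinM muleCA.
Qed.

Lemma Rintegral_arclength (b : R -> R) M x y : measurable_fun setT b ->
  (forall z, `|b z| <= M) -> 0 <= x -> x <= y -> y <= 1 ->
  \int[mu]_(z in `[x, y]) b (rho z) =
  L^-1 * \int[mu]_(z in `[rho x, rho y]) (b z * l z).
Proof.
move=> mb bM x0 xy y1.
have M0 : 0 <= M by exact: le_trans (bM 0).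
have x01 : 0 <= x <= 1 by rewrite x0 (le_trans xy).
have y01 : 0 <= y <= 1 by rewrite y1 (le_trans x0).
have mbr : measurable_fun setT (fun z => b (rho z)).
  exact: (measurableT_comp mb measurable_arclength_inverse).
have lsub : mu.-integrable `[rho x, rho y] (EFin \o l).
  apply: li_sub; first by case/andP: (arclength_inverse_itv x).
  by case/andP: (arclength_inverse_itv y).
have pos (a : R -> R) N : measurable_fun setT a -> (forall z, 0 <= a z <= N) ->
    mu.-integrable `[rho x, rho y] (EFin \o (fun z => a z * l z)) /\
    \int[mu]_(z in `[x, y]) a (rho z) =
    L^-1 * \int[mu]_(z in `[rho x, rho y]) (a z * l z).
  move=> ma aN.
  have ial : mu.-integrable `[rho x, rho y] (EFin \o (fun z => a z * l z)).
    apply: le_integrable (integrable_scaler N _ lsub) => //.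
      by apply/measurable_EFinP; apply: measurable_funM; exact: measurable_funTS.
    move=> z _; have /andP[a0 aN'] := aN z.
    have N0 : 0 <= N by exact: le_trans aN'.
    by rewrite /= lee_fin !normrM (ger0_norm (l0 z)) !ger0_norm// ler_wpM2r.
  split => //.
  pose k z := ((a \_ `[rho x, rho y]) z)%:E.
  have mk : measurable_fun setT k.
    apply/measurable_EFinP; apply/(measurable_restrictT _ _).1 => //.
    exact: measurable_funTS.
  have k0 z : (0 <= k z)%E.
    by rewrite lee_fin patchE; case: ifP => // _; case/andP: (aN z).
  have e := ge0_integral_arclength mk k0.
  transitivity (fine (\int[mu]_(u in `[0%R, 1%R]) k (rho u))%E).
    congr fine.
    have -> : `[x, y]%classic = `[0, 1] `&` `[x, y].
      apply/seteqP; split => [z|z []//]; rewrite /= !in_itv/= => /andP[xz zy].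
      by rewrite xz zy (le_trans x0 xz) (le_trans zy y1).
    rewrite integral_mkcondr; apply: eq_integral => z; rewrite inE/= in_itv/= => z01.
    rewrite /k !patchE; have -> : (rho z \in `[rho x, rho y]%classic) = (z \in `[x, y]%classic).
      by apply/idP/idP; rewrite !inE/= !in_itv/= !arclength_inverse_mono.
    by case: ifP.
  rewrite e; have -> : (\int[mu]_(z in `[0%R, 1%R]) (k z * (l z)%:E) =
      \int[mu]_(z in `[rho x, rho y]) (a z * l z)%:E)%E.
    have -> : `[rho x, rho y]%classic = `[0, 1] `&` `[rho x, rho y].
      apply/seteqP; split => [z|z []//]; rewrite /= !in_itv/= => /andP[xz zy].
      have /andP[rx0 _] := arclength_inverse_itv x.
      have /andP[_ ry1] := arclength_inverse_itv y.
      by rewrite xz zy (le_trans rx0 xz) (le_trans zy ry1).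
    rewrite integral_mkcondr; apply: eq_integral => z _.
    by rewrite /k !patchE; case: ifP => // _; rewrite mul0e.
  rewrite -[X in (_ * X)%E]fineK; last exact: (integrable_fin_num (mu := mu) _ ial).
  by [].
(* A bounded signed function is the difference of the nonnegative functions b + M and M, to which
   [pos] applies. *)
have mbM : measurable_fun setT (fun z => b z + M) by exact: measurable_funD.
have bM2 z : 0 <= b z + M <= M + M.
  by have := bM z; rewrite ler_norml => /andP[]; lra.
have [i1 e1] := pos _ _ mbM bM2.
have MM (z : R) : 0 <= M <= M by rewrite M0 lexx.
have [i2 e2] := pos (fun=> M) M (measurable_cst _) MM.
have -> : \int[mu]_(z in `[x, y]) b (rho z) =
    \int[mu]_(z in `[x, y]) (b (rho z) + M - M).
  by apply: eq_Rintegral => z _; rewrite addrK.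
rewrite RintegralB//; last 2 first.
- apply: (@bounded_integrable_itv _ _ (M + M)); first exact: measurable_funD.
  by move=> z; rewrite (le_trans (ler_normD _ _))// lerD// ger0_norm.
- exact: (@bounded_integrable_itv _ (fun=> M) `|M|).
rewrite e1 e2 -mulrBr -RintegralB//; congr (_ * _).
by apply: eq_Rintegral => z _; ring.
Qed.

End reparametrization.

(** * The du Bois-Reymond lemma on the circle *)

Section trigonometric_polynomials.
Variable R : realType.
Notation mu := (@lebesgue_measure R).

(** Real trigonometric polynomials of period 1: the phase [b] provides the sines and k = 0 the
    constants, so a single generator suffices and differentiation only shifts the phase. *)
Inductive trig : (R -> R) -> Prop :=
| trig_cos (c b : R) (k : nat) : trig (fun x => c * cos (2 * pi * k%:R * x + b))
| trig_add f g : trig f -> trig g -> trig (fun x => f x + g x).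

Lemma trig_cst c : trig (fun=> c).
Proof.
have := trig_cos c 0 0; congr trig; apply/funext => x.
by rewrite mulr0 mul0r addr0 cos0 mulr1.
Qed.

Lemma trig_scale c f : trig f -> trig (fun x => c * f x).
Proof.
elim=> [d b k|g h _ IHg _ IHh].
  by have := trig_cos (c * d) b k; congr trig; apply/funext => x; rewrite mulrA.
by have := trig_add IHg IHh; congr trig; apply/funext => x; rewrite mulrDr.
Qed.

Lemma trig_mul_cos b f : trig f -> trig (fun x => f x * cos (2 * pi * x + b)).
Proof.
have prod (A B c : R) :
    c * cos A * cos B = c / 2 * cos (A + B) + c / 2 * cos (A - B).
  by rewrite cosB cosD; field.
elim=> [c d [|k]|g h _ IHg _ IHh].
(* The frequency 0 is separate, since the product formula for a frequency k + 1 yields k + 2 and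
   k. *)
- have := trig_cos (c * cos d) b 1; congr trig; apply/funext => x.
  by rewrite mulr0 mul0r add0r mulr1.
- have := trig_add (trig_cos (c / 2) (d + b) k.+2) (trig_cos (c / 2) (d - b) k).
  congr trig; apply/funext => x; rewrite prod -!natr1.
  by congr (_ * cos _ + _ * cos _); ring.
- by have := trig_add IHg IHh; congr trig; apply/funext => x; rewrite -mulrDl.
Qed.

Lemma trig_exp c b n : trig (fun x => (c + cos (2 * pi * x + b)) ^+ n).
Proof.
elim: n => [|n IH].
  by have := trig_cst 1; congr trig; apply/funext => x; rewrite expr0.
have := trig_add (trig_scale c IH) (trig_mul_cos b IH).
by congr trig; apply/funext => x; rewrite exprSr; ring.
Qed.

Lemma trig_bounded f : trig f -> exists M : R, forall x, `|f x| <= M.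
Proof.
elim=> [c b k|g h _ [M gM] _ [N hN]].
  exists `|c| => x; rewrite normrM ler_piMr// ler_norml.
  by rewrite cos_geN1 cos_le1.
by exists (M + N) => x; rewrite (le_trans (ler_normD _ _))// lerD.
Qed.

Lemma trig_periodic f : trig f -> periodic f 1.
Proof.
elim=> [c b k x|g h _ IHg _ IHh x]; last by rewrite IHg IHh.
congr (_ * _).
have -> : 2 * pi * k%:R * (x + 1) + b = 2 * pi * k%:R * x + b + (pi *+ 2) *+ k.
  by rewrite -[X in _ = _ + X]mulr_natr -[pi *+ 2]mulr_natl; ring.
by elim: k (2 * pi * _ * x + b) => [|k IH] y; rewrite ?addr0// mulrSr addrA cosD2pi IH.
Qed.

Lemma is_derive_cos_affine (w b c x : R) :
  is_derive x 1 (fun x => c * cos (w * x + b)) (- (c * w) * sin (w * x + b)).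
Proof.
have d1 : is_derive x 1 (fun x : R => w * x + b) w.
  have d := is_deriveD (is_deriveZ w (is_derive_id x 1)) (is_derive_cst b x 1).
  by apply: (is_derive_eq d); rewrite addr0 -[LHS]/(w * 1) mulr1.
have d2 := is_deriveZ c (@is_derive1_comp R cos (fun x => w * x + b) x _ _
  (is_derive_cos (w * x + b)) d1).
by apply: (is_derive_eq d2); rewrite -[LHS]/(c * _); ring.
Qed.

Lemma trig_derive f : trig f -> exists2 g, trig g &
  forall x : R, is_derive x 1 f (g x).
Proof.
elim=> [c b k|g h _ [g' tg dg] _ [h' th dh]].
  exists (fun x => c * (2 * pi * k%:R) * cos (2 * pi * k%:R * x + (b + pi / 2))).
    exact: trig_cos.
  move=> x; apply: (is_derive_eq (is_derive_cos_affine _ _ _ _)).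
  by rewrite addrA cosDpihalf; ring.
by exists (fun x => g' x + h' x) => [|x]; [exact: trig_add|exact: is_deriveD].
Qed.

(** Here [m] is the constant term of [f], the only obstruction to a periodic primitive. *)
Lemma trig_primitive f : trig f -> exists m, exists2 g, trig g &
  forall x : R, is_derive x 1 g (f x - m).
Proof.
elim=> [c b [|k]|g h _ [m [G tG dG]] _ [m' [H tH dH]]].
- exists (c * cos b), (fun=> 0); first exact: trig_cst.
  move=> x; apply: (is_derive_eq (is_derive_cst _ _ _)).
  by rewrite mulr0 mul0r add0r subrr.
- exists 0; set w : R := 2 * pi * k.+1%:R.
  have w0 : w != 0 by rewrite !mulf_neq0// ?pnatr_eq0// gt_eqF// pi_gt0.
  exists (fun x => c / w * cos (w * x + (b - pi / 2))); first exact: trig_cos.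
  move=> x; apply: (is_derive_eq (is_derive_cos_affine _ _ _ _)).
  rewrite -[w * x + b](subrK (pi / 2)) cosDpihalf -addrA mulfVK//; ring.
- exists (m + m'), (fun x => G x + H x); first exact: trig_add.
  by move=> x; apply: (is_derive_eq (is_deriveD (dG x) (dH x))); ring.
Qed.

Lemma trig_derive1 f : trig f -> trig (derive1 f).
Proof.
move=> /trig_derive[g tg dg].
rewrite (_ : derive1 f = g)//; apply/funext => x.
by rewrite derive1E; apply: derive_val.
Qed.

Lemma trig_derivable f x : trig f -> derivable f x 1.
Proof. by move=> /trig_derive[g _ dg]; have [] := dg x. Qed.

Lemma trig_smooth f : trig f -> smooth f.
Proof.
move=> tf n x; apply: trig_derivable.
by elim: n => [//|n IH]; rewrite derive1nS; exact: trig_derive1.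
Qed.

Lemma trig_continuous f : trig f -> continuous f.
Proof.
by move=> tf x; apply: differentiable_continuous; apply/derivable1_diffP;
  exact: trig_derivable.
Qed.

Lemma trig_measurable f : trig f -> measurable_fun setT f.
Proof. by move=> tf; apply: continuous_measurable_fun; exact: trig_continuous. Qed.

Lemma trig_ftc f a b : trig f -> a <= b ->
  \int[mu]_(x in `[a, b]) derive1 f x = f b - f a.
Proof.
move=> tf; rewrite le_eqVlt => /predU1P[->|ab].
  by rewrite set_itv1 Rintegral_set1 subrr.
rewrite /Rintegral (@continuous_FTC2 _ _ f)//.
- apply: continuous_subspaceT; apply: trig_continuous; exact: trig_derive1.
- split=> [x _||].
  + exact: trig_derivable.
  + by apply: cvg_at_right_filter; exact: trig_continuous.
  + by apply: cvg_at_left_filter; exact: trig_continuous.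
Qed.

(** * A trigonometric kernel concentrating at a point *)

Section concentrating_kernel.
Variables (a del : R).
Hypotheses (del0 : 0 < del) (dela : del <= a) (dela1 : del <= 1 - a).

(** The constant is chosen so that the value is 1 at circle distance [del] from [a], larger than 1
    closer to [a], and in [-1, 1] farther away. Powers therefore grow only near [a]. The bounds on
    [del] keep the neighbourhood of [a] inside [0, 1]. *)
Definition cos_kernel (x : R) :=
  1 - cos (2 * pi * del) + cos (2 * pi * x + (- (2 * pi * a))).

Let pi0 : 0 < pi :> R. Proof. exact: pi_gt0. Qed.

Let del2 : del <= 1 / 2. Proof. by move: dela dela1; lra. Qed.

Let two_pi_ge0 x : 0 <= x -> 0 <= 2 * pi * x :> R.
Proof. by move=> x0; rewrite !mulr_ge0// ltW. Qed.

Let two_pi_le x y : x <= y -> 2 * pi * x <= 2 * pi * y :> R.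
Proof. by move=> xy; rewrite ler_wpM2l// mulr_ge0// ltW. Qed.

Let two_pi_lepi x : x <= 1 / 2 -> 2 * pi * x <= pi :> R.
Proof.
move=> x2; apply: le_trans (two_pi_le x2) _.
by rewrite le_eqVlt; apply/orP; left; apply/eqP; field.
Qed.

Let kernelE x :
  cos_kernel x = 1 - cos (2 * pi * del) + cos (2 * pi * `|x - a|).
Proof.
rewrite /cos_kernel; congr (_ + _).
have -> : 2 * pi * x - 2 * pi * a = 2 * pi * (x - a) by ring.
have [xa|xa] := leP 0 (x - a); first by rewrite ger0_norm.
by rewrite ltr0_norm// mulrN cosN.
Qed.

Lemma cos_kernel_near : exists2 eta, 0 < eta &
  forall x, `|x - a| <= del / 2 -> 1 + eta <= cos_kernel x.
Proof.
have d20 : 0 <= del / 2 by rewrite divr_ge0// ltW.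
have dd : del / 2 < del by rewrite ltr_pdivrMr// mulr_natr mulr2n ltrDl.
exists (cos (2 * pi * (del / 2)) - cos (2 * pi * del)).
  rewrite subr_gt0; apply: cos_lt; [exact: two_pi_ge0| |exact: two_pi_lepi].
  by rewrite ltr_pM2l ?mulr_gt0.
move=> x xa; rewrite kernelE addrA [1 + _ - _]addrAC lerD2l.
apply: cos_le; [exact: two_pi_ge0|exact: two_pi_le|].
by apply: two_pi_lepi; rewrite (le_trans _ del2)// ltW.
Qed.

Lemma cos_kernel_mid x : `|x - a| <= del -> 1 <= cos_kernel x.
Proof.
move=> xa; rewrite kernelE -addrA lerDl addrC subr_ge0.
by apply: cos_le; [exact: two_pi_ge0|exact: two_pi_le|exact: two_pi_lepi].
Qed.

Lemma cos_kernel_far x : 0 <= x <= 1 -> del <= `|x - a| -> `|cos_kernel x| <= 1.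
Proof.
move=> x01 xa.
have xa1 : `|x - a| <= 1 - del by move: del0 dela dela1; rewrite ler_norml; lra.
have {x01} : cos (2 * pi * `|x - a|) <= cos (2 * pi * del).
  have dge0 := two_pi_ge0 (ltW del0).
  have [x2|/ltW x2] := leP `|x - a| (1 / 2).
    by apply: cos_le => //; [exact: two_pi_le|exact: two_pi_lepi].
  rewrite (_ : cos (2 * pi * `|x - a|) = cos (2 * pi * (1 - `|x - a|))).
    apply: cos_le => //; first by apply: two_pi_le; rewrite lerBrDl addrC -lerBrDl.
    by apply: two_pi_lepi; lra.
  rewrite -[RHS]cosN -[RHS]cosD2pi; congr cos.
  by rewrite -[pi *+ 2]mulr_natl; ring.
rewrite kernelE; move: (cos_geN1 (2 * pi * `|x - a|)) (cos_le1 (2 * pi * del)).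
move: (cos _) (cos _) => y z; rewrite ler_norml; lra.
Qed.

Lemma trig_cos_kernel_exp m : trig (fun x => cos_kernel x ^+ m).
Proof. exact: trig_exp. Qed.

End concentrating_kernel.

(* If H a > 0, test H against the powers of the kernel, which concentrate near a. *)
Lemma continuous_trig_orthogonal_le0 (H : R -> R) a : 0 < a < 1 ->
  {within `[0, 1], continuous H} ->
  (forall f, trig f -> \int[mu]_(x in `[0, 1]) (H x * f x) = 0) -> H a <= 0.
Proof.
move=> /andP[a0 a1] cH orth; rewrite leNgt; apply/negP => Ha.
have a01 : `[0, 1]%classic a by rewrite /= in_itv/= !ltW.
have iH : mu.-integrable `[0, 1] (EFin \o H).
  by apply: continuous_compact_integrable => //; exact: segment_compact.
have [del [del0 [dela [dela1 Hdel]]]] : exists del, 0 < del /\ del <= a /\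
    del <= 1 - a /\ forall x, `|x - a| <= del -> H a / 2 <= H x.
  move/subspace_continuousP : cH => /(_ a a01) /cvgrPdist_lt.
  have h2 : 0 < H a / 2 by rewrite divr_gt0.
  move=> /(_ _ h2); rewrite /prop_near1/= => -[e/= e0 eP].
  exists (Num.min (e / 2) (Num.min a (1 - a))).
  have da : Num.min (e / 2) (Num.min a (1 - a)) <= a by rewrite !ge_min lexx !orbT.
  have da1 : Num.min (e / 2) (Num.min a (1 - a)) <= 1 - a.
    by rewrite !ge_min lexx !orbT.
  have de : Num.min (e / 2) (Num.min a (1 - a)) <= e / 2 by rewrite ge_min lexx.
  split; first by rewrite !lt_min a0 divr_gt0//= subr_gt0.
  split => //; split => // x xd.
  have xa := le_trans xd da; have xa1 := le_trans xd da1; have xe := le_trans xd de.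
  move: xa xa1; rewrite !ler_norml => xa xa1.
  have : `|H a - H x| < H a / 2.
    apply: eP; first by rewrite /= distrC; lra.
    by rewrite /= in_itv/=; lra.
  by rewrite ltr_norml; lra.
have [M HM] : exists M, forall x, 0 <= x <= 1 -> `|H x| <= M.
  have cN : {within `[0, 1], continuous (fun x => `|H x|)}.
    apply/subspace_continuousP => x x01; apply: cvg_norm.
    by move/subspace_continuousP : cH; exact.
  have [c _ cmax] := EVT_max ler01 cN.
  by exists `|H c| => x x01; apply: cmax; rewrite in_itv.
have M0 : 0 <= M by apply: le_trans (normr_ge0 _) (HM 0 _); rewrite lexx ler01.
have q_mid x : `|x - a| <= del -> 1 <= cos_kernel a del x.
  exact: cos_kernel_mid.
have q_far x : 0 <= x <= 1 -> del <= `|x - a| -> `|cos_kernel a del x| <= 1.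
  exact: cos_kernel_far.
have [eta eta0 q_near] := cos_kernel_near del0 dela dela1.
have Ha2 : 0 <= H a / 2 by rewrite divr_ge0// ltW.
have key n : (H a / 2) * (1 + n%:R * eta) * del <= M.
  pose f x := cos_kernel a del x ^+ n.
  have tf : trig f by exact: trig_cos_kernel_exp.
  have [N fN] := trig_bounded tf.
  pose I := `[a - del / 2, a + del / 2]%classic : set R.
  have iI (r : R) : mu.-integrable `[0, 1] (EFin \o (fun x => r * \1_I x)).
    apply: (@bounded_integrable_itv _ (fun x => r * \1_I x) `|r|).
      by apply: measurable_funM => //; apply: measurable_indic; exact: measurable_itv.
    by move=> x; rewrite indicE; case: (x \in I); rewrite ?mulr1 ?mulr0 ?normr0.
  have iM : mu.-integrable `[0, 1] (EFin \o (fun=> M)).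
    exact: (@bounded_integrable_itv _ (fun=> M) `|M|).
  (* Three zones: within del / 2 of [a], Bernoulli's inequality makes f at least 1 + n eta; up to
     distance del the product is nonnegative; beyond, |f| <= 1 and the product is at least -M.
     Integrating, with [I] of length del, gives a bound that is violated for large n. *)
  have fM x : 0 <= x <= 1 -> H a / 2 * (1 + n%:R * eta) * \1_I x - M <= H x * f x.
    move=> x01; have HMx := HM _ x01.
    have [xI|xI] := leP `|x - a| (del / 2).
      have Ix : x \in I by rewrite inE /I /= in_itv/=; move: xI; rewrite ler_norml; lra.
      rewrite indicE Ix mulr1.
      have h1 : H a / 2 <= H x by apply: Hdel; lra.
      have h2 : 1 + n%:R * eta <= f x.
        apply: (@le_trans _ _ ((1 + eta) ^+ n)).
          elim: n {f tf fN iI} => [|n IH]; first by rewrite mul0r addr0 expr0.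
          rewrite exprS; apply: (@le_trans _ _ ((1 + eta) * (1 + n%:R * eta))).
            rewrite -natr1; have : 0 <= n%:R * eta * eta.
              by rewrite !mulr_ge0// ltW.
            by lra.
          by rewrite ler_wpM2l// addr_ge0// ltW.
        have qx := q_near _ xI; have e1 : 0 <= 1 + eta by lra.
        by rewrite /f lerXn2r ?nnegrE//; exact: le_trans qx.
      apply: (@le_trans _ _ (H a / 2 * (1 + n%:R * eta))); first by lra.
      apply: ler_pM => //.
      by rewrite addr_ge0// mulr_ge0// ltW.
    have Ix : x \in I = false.
      apply/negbTE/negP; rewrite inE /I /= in_itv/= => h.
      by move: xI; rewrite ltNge ler_norml; case/negP; lra.
    rewrite indicE Ix mulr0 sub0r.
    have [xd|xd] := leP `|x - a| del.
      apply: (@le_trans _ _ 0); first by rewrite oppr_le0.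
      rewrite mulr_ge0//; first by have := Hdel _ xd; lra.
      by rewrite exprn_ge0//; have := q_mid _ xd; lra.
    have : `|H x * f x| <= M.
      rewrite normrM -[M]mulr1 ler_pM// /f normrX exprn_ile1//.
      exact: q_far (ltW xd).
    by rewrite ler_norml => /andP[].
  have iHf : mu.-integrable `[0, 1] (EFin \o (fun x => H x * f x)).
    have cHf : {within `[0, 1], continuous (fun x => H x * f x)}.
      apply/subspace_continuousP => x x01; apply: cvgM.
        by move/subspace_continuousP : cH; exact.
      have : {within `[0, 1], continuous f}.
        by apply: continuous_subspaceT; exact: trig_continuous.
      by move/subspace_continuousP; exact.
    by apply: continuous_compact_integrable => //; exact: segment_compact.
  have : \int[mu]_(x in `[0, 1]) (H a / 2 * (1 + n%:R * eta) * \1_I x - M) <= 0.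
    apply: (@le_trans _ _ (\int[mu]_(x in `[0, 1]) (H x * f x))); last by rewrite orth.
    by apply: le_Rintegral => //; exact: integrable_subr.
  rewrite RintegralB// Rintegral_itv_cst// subr0 mulr1 subr_le0; apply: le_trans.
  have -> : \int[mu]_(x in `[0, 1]) (H a / 2 * (1 + n%:R * eta) * \1_I x) =
      \int[mu]_(x in I) (H a / 2 * (1 + n%:R * eta)).
    have IE : I = `[0, 1] `&` I.
      apply/seteqP; split => [x xI|x []//]; split => //.
      by move: xI; rewrite /I /= !in_itv/=; lra.
    rewrite [in RHS]IE Rintegral_mkcondr; apply: eq_Rintegral => x _.
    by rewrite patchE indicE; case: ifP; rewrite ?mulr1 ?mulr0.
  rewrite Rintegral_itv_cst; last lra.
  by rewrite le_eqVlt; apply/orP; left; apply/eqP; field.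
have Hp : 0 < H a / 2 * eta * del by rewrite !mulr_gt0 ?divr_gt0.
have := key (Num.truncn (M / (H a / 2 * eta * del))).+1.
have := truncnS_gt (M / (H a / 2 * eta * del)).
set n := (_.+1); rewrite ltr_pdivrMr// => h1 h2.
have : 0 < H a / 2 * del by rewrite mulr_gt0 ?divr_gt0.
move: h1 h2; move: (n%:R) => k; nra.
Qed.

Lemma continuous_trig_orthogonal_eq0 (H : R -> R) a : 0 < a < 1 ->
  {within `[0, 1], continuous H} ->
  (forall f, trig f -> \int[mu]_(x in `[0, 1]) (H x * f x) = 0) -> H a = 0.
Proof.
move=> a01 cH orth; apply/eqP; rewrite eq_le.
rewrite continuous_trig_orthogonal_le0//= -oppr_le0.
apply: (@continuous_trig_orthogonal_le0 (fun x => - H x)) => //.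
  apply/subspace_continuousP => x x01; apply: cvgN.
  by move/subspace_continuousP : cH; exact.
move=> f tf; rewrite -[RHS](orth _ (trig_scale (-1) tf)).
by apply: eq_Rintegral => x _; rewrite mulN1r mulrN mulNr.
Qed.

End trigonometric_polynomials.

(** * From the weak derivative to a primitive *)

Section du_bois_reymond.
Variable R : realType.
Notation mu := (@lebesgue_measure R).
Implicit Types u v f g F phi psi : R -> R.

Lemma integrable_mulr_bounded u v M (D : set (measurableTypeR R)) : measurable D ->
  mu.-integrable D (EFin \o u) -> measurable_fun setT v ->
  (forall x, `|v x| <= M) -> mu.-integrable D (EFin \o (fun x => u x * v x)).
Proof.
move=> mD iu mv vM.
have M0 : 0 <= M by exact: le_trans (vM 0).
have iM : mu.-integrable D (EFin \o (fun x => M * `|u x|)).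
  apply: integrable_scaler => //.
  have := integrable_abse iu; by apply: eq_integrable => // x _.
apply: le_integrable iM => //.
  apply/measurable_EFinP; apply: measurable_funM; last exact: measurable_funTS.
  by apply/measurable_EFinP; exact: measurable_int iu.
move=> x _; rewrite /= lee_fin normrM (ger0_norm (mulr_ge0 _ _))// mulrC.
by rewrite ler_wpM2r.
Qed.

(** Fubini on the triangle x <= y. It serves as integration by parts when [u] is merely
    integrable. *)
Lemma Rintegral_triangle_swap u v M : measurable_fun setT u ->
  mu.-integrable `[0, 1] (EFin \o u) -> measurable_fun setT v ->
  (forall x, `|v x| <= M) ->
  \int[mu]_(x in `[0, 1]) (u x * \int[mu]_(y in `[x, 1]) v y) =
  \int[mu]_(y in `[0, 1]) (v y * \int[mu]_(x in `[0, y]) u x).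
Proof.
move=> mu' iu mv vM.
have M0 : 0 <= M by exact: le_trans (vM 0).
pose k (z : measurableTypeR R * measurableTypeR R) : R :=
  (u \_ `[0, 1]) z.1 * (v \_ `[0, 1]) z.2 * (if z.1 <= z.2 then 1 else 0).
have mr (w : R -> R) : measurable_fun setT w -> measurable_fun setT (w \_ `[0, 1]).
  move=> mw; apply/(measurable_restrictT _ _).1 => //.
  exact: measurable_funTS.
have mk : measurable_fun setT k.
  apply: measurable_funM.
    apply: measurable_funM.
      exact: (measurableT_comp (mr _ mu') measurable_fst).
    exact: (measurableT_comp (mr _ mv) measurable_snd).
  apply: measurable_fun_ifT => //.
  by apply: measurable_fun_ler; [exact: measurable_fst|exact: measurable_snd].
have iuT : mu.-integrable setT (EFin \o (u \_ `[0, 1])).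
  by rewrite -restrict_EFin; apply/integrable_restrict => //; rewrite setTI.
have i1 (r : R) : mu.-integrable `[0, 1] (EFin \o (fun=> r)).
  exact: (@bounded_integrable_itv _ (fun=> r) `|r|).
have ik : (mu \x mu)%E.-integrable setT (EFin \o k).
  apply/integrable12ltyP; first exact/measurable_EFinP.
  apply: (@le_lt_trans _ _ (\int[mu]_x (M * `|(u \_ `[0, 1]) x|)%:E)%E); last first.
    have : mu.-integrable setT (EFin \o (fun x => M * `|(u \_ `[0, 1]) x|)).
      apply: integrable_scaler => //.
      by have := integrable_abse iuT; apply: eq_integrable => // x _.
    move=> /integrableP[_]; apply: le_lt_trans; apply: ge0_le_integral => //.
    + by move=> x _; rewrite lee_fin mulr_ge0.
    + apply/measurable_EFinP; apply: measurable_funM => //.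
      by apply: measurableT_comp => //; exact: mr.
    + apply: measurableT_comp => //; apply/measurable_EFinP; apply: measurable_funM => //.
      by apply: measurableT_comp => //; exact: mr.
    + by move=> x _ /=; rewrite lee_fin ler_norm.
  apply: ge0_le_integral => //.
  + by move=> x _; apply: integral_ge0.
  + apply: (@measurable_fun_fubini_tonelli_F _ _ (measurableTypeR R) (measurableTypeR R)
      R mu (fun z => `|(k z)%:E|)%E) => //.
    by apply: measurableT_comp => //; exact/measurable_EFinP.
  + apply/measurable_EFinP; apply: measurable_funM => //.
    by apply: measurableT_comp => //; exact: mr.
  move=> x _.
  apply: (@le_trans _ _ (\int[mu]_(y in `[0%R, 1%R]) (M * `|(u \_ `[0, 1]) x|)%:E)%E); last first.
    by rewrite integral_cst//= lebesgue_measure_itv/= lte01 -EFinB subr0 mule1.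
  rewrite [leRHS]integral_mkcond; apply: ge0_le_integral => //.
  + apply: measurableT_comp => //; apply/measurable_EFinP.
    exact: (measurableT_comp mk (pair1_measurable (x : measurableTypeR R))).
  + by apply/(measurable_restrictT _ _).1.
  + move=> y _; rewrite /k /= [in leRHS]patchE [(v \_ _) y]patchE; case: ifP => _.
      rewrite lee_fin !normrM [M * _]mulrC -mulrA ler_wpM2l//.
      by case: ifP => _; rewrite ?normr1 ?normr0 ?mulr1 ?mulr0.
    by rewrite mulr0 mul0r normr0.
have FE x : (\int[mu]_y (k (x, y))%:E)%E =
    ((fun x => u x * \int[mu]_(y in `[x, 1]) v y) \_ `[0, 1] x)%:E.
  rewrite patchE /k /=; case: ifPn => x01; last first.
    rewrite integral0_eq// => y _; rewrite [(u \_ _) x]patchE (negbTE x01).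
    by rewrite !mul0r.
  have iv : mu.-integrable `[x, 1] (EFin \o v) by exact: (bounded_integrable_itv _ _ mv vM).
  rewrite -RintegralZl// /Rintegral fineK; last first.
    by apply: (integrable_fin_num (mu := mu)) => //; exact: integrable_scaler.
  rewrite [RHS]integral_mkcond; apply: eq_integral => y _.
  rewrite !patchE x01; move: x01; rewrite inE/= in_itv/= => /andP[x0 x1].
  have [xy|yx] := leP x y.
    rewrite mulr1; have -> : (y \in `[x, 1]%classic) = (y \in `[0, 1]%classic).
      by apply/idP/idP; rewrite !inE/= !in_itv/= => /andP[]; lra.
    by case: ifP => _; rewrite ?mulr0.
  rewrite mulr0 ifF//; apply/negbTE/negP; rewrite inE/= in_itv/= => /andP[].
  lra.
have GE y : (\int[mu]_x (k (x, y))%:E)%E =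
    ((fun y => v y * \int[mu]_(x in `[0, y]) u x) \_ `[0, 1] y)%:E.
  rewrite patchE /k /=; case: ifPn => y01; last first.
    rewrite integral0_eq// => x _; rewrite [(v \_ _) y]patchE (negbTE y01).
    by rewrite mulr0 mul0r.
  have iv : mu.-integrable `[0, y] (EFin \o u).
    by apply: integrable_sub_itv iu => //; move: y01; rewrite inE/= in_itv/= => /andP[].
  rewrite -RintegralZl// /Rintegral fineK; last first.
    by apply: (integrable_fin_num (mu := mu)) => //; exact: integrable_scaler.
  rewrite [RHS]integral_mkcond; apply: eq_integral => x _.
  rewrite !patchE y01; move: y01; rewrite inE/= in_itv/= => /andP[y0 y1].
  have [xy|yx] := leP x y.
    rewrite mulr1; have -> : (x \in `[0, y]%classic) = (x \in `[0, 1]%classic).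
      by apply/idP/idP; rewrite !inE/= !in_itv/= => /andP[]; lra.
    by rewrite mulrC; case: ifP => _; rewrite ?mulr0.
  rewrite mulr0 ifF//; apply/negbTE/negP; rewrite inE/= in_itv/= => /andP[].
  lra.
have := @Fubini _ _ (measurableTypeR R) (measurableTypeR R) R mu mu _ ik.
rewrite /fubini_F /fubini_G /=.
under eq_integral do rewrite FE.
under [in RHS]eq_integral do rewrite GE.
move=> e; rewrite Rintegral_mkcond [RHS]Rintegral_mkcond /Rintegral.
by rewrite e.
Qed.

Lemma integrable_primitive u : mu.-integrable `[0, 1] (EFin \o u) ->
  mu.-integrable `[0, 1] (EFin \o (fun y => \int[mu]_(x in `[0, y]) u x)).
Proof.
move=> iu; apply: continuous_compact_integrable; first exact: segment_compact.
exact: (parameterized_integral_continuous ler01 iu).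
Qed.

Lemma trig_mul_integrable u phi : mu.-integrable `[0, 1] (EFin \o u) -> trig phi ->
  mu.-integrable `[0, 1] (EFin \o (fun x => u x * phi x)).
Proof.
move=> iu tphi; have [M phiM] := trig_bounded tphi.
by apply: integrable_mulr_bounded phiM => //; exact: trig_measurable.
Qed.

(** The inner integral of phi' over [x, 1] is phi 1 - phi x, and the boundary term with phi 1 drops
    out because [u] has mean zero. *)
Lemma trig_by_parts u phi : measurable_fun setT u ->
  mu.-integrable `[0, 1] (EFin \o u) -> \int[mu]_(x in `[0, 1]) u x = 0 ->
  trig phi ->
  \int[mu]_(x in `[0, 1]) (u x * phi x) =
  - \int[mu]_(y in `[0, 1]) ((\int[mu]_(x in `[0, y]) u x) * derive1 phi y).
Proof.
move=> mu' iu u0 tphi; have td := trig_derive1 tphi.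
have [M phiM] := trig_bounded td.
have e := Rintegral_triangle_swap mu' iu (trig_measurable td) phiM.
under [in RHS]eq_Rintegral do rewrite mulrC.
rewrite -e.
have -> : \int[mu]_(x in `[0, 1]) (u x * \int[mu]_(y in `[x, 1]) derive1 phi y) =
    \int[mu]_(x in `[0, 1]) (phi 1 * u x - u x * phi x).
  apply: eq_Rintegral => x; rewrite inE/= in_itv/= => /andP[_ x1].
  by rewrite trig_ftc//; ring.
rewrite RintegralB//; last 2 first.
- exact: integrable_scaler.
- exact: trig_mul_integrable.
by rewrite RintegralZl// u0 mulr0 sub0r opprK.
Qed.

(** Every trigonometric polynomial is the derivative of another one plus a constant, and F minus its
    mean is orthogonal to both. *)
Lemma trig_orthogonal_mean F : mu.-integrable `[0, 1] (EFin \o F) ->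
  (forall phi, trig phi -> \int[mu]_(x in `[0, 1]) (F x * derive1 phi x) = 0) ->
  forall psi, trig psi ->
  \int[mu]_(x in `[0, 1]) ((F x - \int[mu]_(z in `[0, 1]) F z) * psi x) = 0.
Proof.
move=> iF orth psi tpsi; set m := (\int[mu]_(z in `[0, 1]) F z).
have [c [phi tphi dphi]] := trig_primitive tpsi.
have i1 (r : R) : mu.-integrable `[0, 1] (EFin \o (fun=> r)).
  exact: (@bounded_integrable_itv _ (fun=> r) `|r|).
have psiE x : psi x = derive1 phi x + c.
  by have d := dphi x; rewrite derive1E derive_val subrK.
have td := trig_derive1 tphi.
have id1 : mu.-integrable `[0, 1] (EFin \o derive1 phi).
  have [M phiM] := trig_bounded td.
  by apply: (bounded_integrable_itv _ _ _ phiM); exact: trig_measurable.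
have -> : \int[mu]_(x in `[0, 1]) ((F x - m) * psi x) =
    \int[mu]_(x in `[0, 1])
      ((F x * derive1 phi x + c * F x) - (m * derive1 phi x + m * c)).
  by apply: eq_Rintegral => x _; rewrite psiE; ring.
have iFd := trig_mul_integrable iF td.
rewrite RintegralB//; last 2 first.
- by apply: integrable_addr => //; exact: integrable_scaler.
- by apply: integrable_addr => //; exact: integrable_scaler.
rewrite !RintegralD//; try exact: integrable_scaler.
rewrite orth// !RintegralZl// -/m trig_ftc// Rintegral_itv_cst//.
have -> : phi 1 = phi 0 by rewrite -[X in phi X]add0r (trig_periodic tphi).
by ring.
Qed.

(** By Lebesgue differentiation, [u] is almost everywhere the derivative of its primitive, here a
    constant. *)
Lemma primitive_cst_ae0 u k : mu.-integrable `[0, 1] (EFin \o u) ->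
  (forall x, 0 < x < 1 -> \int[mu]_(z in `[0, x]) u z = k) ->
  {ae mu, forall x, 0 < x < 1 -> u x = 0}.
Proof.
move=> iu uk; pose v := u \_ `[0, 1].
have ivT : mu.-integrable setT (EFin \o v).
  by rewrite -restrict_EFin; apply/integrable_restrict => //; rewrite setTI.
have ivy y : mu.-integrable [set` Interval (BLeft 0) (BRight y)] (EFin \o v).
  exact: integrableS ivT.
have /= := @FTC1 R v (BLeft 0) ivy (integrable_locally (measurable_itv _) iu).
move=> [N [mN N0 sN]]; exists N; split => // x /= /not_implyP[x01 ux].
apply: sN => /= ftc; apply: ux.
have [|_ dv] := ftc; first by rewrite lte_fin; case/andP: x01.
have vx : v x = 0.
  rewrite -dv derive1E -[RHS](derive_cst k x 1); apply: near_eq_derive.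
  have : x \in `]0, 1[ by rewrite in_itv.
  move=> /near_in_itvoo; apply: filterS => y; rewrite in_itv/= => y01.
  rewrite -(uk y y01); apply: eq_Rintegral => z; rewrite inE/= in_itv/= => /andP[z0 zy].
  by rewrite /v patchE ifT// inE/= in_itv/=; lra.
by move: vx; rewrite /v patchE ifT// inE/= in_itv/=; lra.
Qed.

(** The difference h of f and the primitive of g is orthogonal to all phi', so h minus its mean is
    orthogonal to all trigonometric polynomials. The kernel test needs a continuous function, so it
    is applied to the primitive [H] of that difference: [H] minus its mean is again orthogonal to
    them, so [H] is constant inside the interval, and differentiating gives h = m almost
    everywhere. *)
Lemma du_bois_reymond f g : measurable_fun setT f -> measurable_fun setT g ->
  mu.-integrable `[0, 1] (EFin \o f) -> mu.-integrable `[0, 1] (EFin \o g) ->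
  (forall phi, trig phi -> \int[mu]_(x in `[0, 1]) (f x * derive1 phi x) =
    - \int[mu]_(x in `[0, 1]) (g x * phi x)) ->
  \int[mu]_(x in `[0, 1]) g x = 0 /\
  exists C, {ae mu, forall x, 0 <= x <= 1 -> f x = C + \int[mu]_(z in `[0, x]) g z}.
Proof.
move=> mf mg i_f i_g weak.
have g0 : \int[mu]_(x in `[0, 1]) g x = 0.
  have := weak _ (trig_cst 1).
  under eq_Rintegral do rewrite derive1_cst mulr0.
  under [in RHS]eq_Rintegral do rewrite mulr1.
  rewrite Rintegral_itv_cst// mul0r => /eqP.
  by rewrite eq_sym oppr_eq0 => /eqP.
split => //.
pose G y := \int[mu]_(x in `[0, y]) g x.
have iG : mu.-integrable `[0, 1] (EFin \o G) by exact: integrable_primitive.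
pose h x := f x - G x.
have ih : mu.-integrable `[0, 1] (EFin \o h) by exact: integrable_subr.
have horth phi : trig phi -> \int[mu]_(x in `[0, 1]) (h x * derive1 phi x) = 0.
  move=> tphi; have td := trig_derive1 tphi.
  under eq_Rintegral do rewrite /h mulrBl.
  rewrite RintegralB//; [|exact: trig_mul_integrable..].
  by rewrite weak// (trig_by_parts mg i_g g0 tphi) opprK subrr.
pose m := \int[mu]_(x in `[0, 1]) h x.
have i1 (r : R) : mu.-integrable `[0, 1] (EFin \o (fun=> r)).
  exact: (@bounded_integrable_itv _ (fun=> r) `|r|).
(* The cut-off gives measurability on the whole line, as [trig_by_parts] requires. *)
pose h0 := (fun x => h x - m) \_ `[0, 1].
have h0E : {in `[0, 1]%classic, h0 =1 fun x => h x - m}.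
  by move=> x x01; rewrite /h0 patchE x01.
have ihm : mu.-integrable `[0, 1] (EFin \o (fun x => h x - m)).
  exact: integrable_subr.
have mh0 : measurable_fun setT h0.
  apply/(measurable_restrictT _ _).1 => //.
  by apply/measurable_EFinP; exact: measurable_int ihm.
have ih0T : mu.-integrable setT (EFin \o h0).
  by rewrite -restrict_EFin; apply/integrable_restrict => //; rewrite setTI.
have ih0 : mu.-integrable `[0, 1] (EFin \o h0) by exact: integrableS ih0T.
have h0orth psi : trig psi -> \int[mu]_(x in `[0, 1]) (h0 x * psi x) = 0.
  move=> tpsi; rewrite -[RHS](trig_orthogonal_mean ih horth tpsi).
  by apply: eq_Rintegral => x x01; rewrite h0E.
have h00 : \int[mu]_(x in `[0, 1]) h0 x = 0.
  rewrite -[RHS](h0orth _ (trig_cst 1)).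
  by apply: eq_Rintegral => x _; rewrite mulr1.
pose H y := \int[mu]_(x in `[0, y]) h0 x.
have iH : mu.-integrable `[0, 1] (EFin \o H) by exact: integrable_primitive.
have Horth phi : trig phi -> \int[mu]_(x in `[0, 1]) (H x * derive1 phi x) = 0.
  move=> tphi; apply/eqP; rewrite -oppr_eq0 -(trig_by_parts mh0 ih0 h00 tphi).
  by rewrite h0orth.
have Hcst a : 0 < a < 1 -> H a = \int[mu]_(x in `[0, 1]) H x.
  move=> a01; apply/eqP; rewrite -subr_eq0; apply/eqP.
  apply: (@continuous_trig_orthogonal_eq0 R (fun x => H x - \int[mu]_(x in `[0, 1]) H x)) => //.
    have := parameterized_integral_continuous ler01 ih0.
    move=> /subspace_continuousP cH; apply/subspace_continuousP => x x01.
    by apply: cvgB; [exact: cH|exact: cvg_cst].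
  exact: trig_orthogonal_mean.
have [N [mN N0 sN]] := primitive_cst_ae0 ih0 Hcst.
have c01 : countable ([set 0; 1] : set R) by exact/finite_set_countable/finite_set2.
have m01 : measurable ([set 0; 1] : set R) by exact: countable_measurable c01.
exists m, (N `|` [set 0; 1]); split.
- exact: measurableU.
- by rewrite measureU0//; exact: countable_lebesgue_measure0.
move=> x /= /not_implyP[/andP[x0 x1] fx].
have [->|xn0] := eqVneq x 0; first by right; left.
have [->|xn1] := eqVneq x 1; first by right; right.
have x01 : 0 < x < 1 by rewrite !lt_neqAle x0 x1 xn1 eq_sym xn0.
left; apply: sN => /= h0x; apply: fx; have := h0x x01.
by rewrite h0E ?inE/= ?in_itv/= ?x0//= /h -/(G x); lra.
Qed.

End du_bois_reymond.

(** * Regular closed curves *)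

Section periodic_extension.
Variable R : realType.

Definition frac (x : R) : R := x - (Num.floor x)%:~R.

Lemma frac_itv x : 0 <= frac x < 1.
Proof.
by rewrite /frac subr_ge0 ltrBlDl -[X in _ < _ + X]/(1%:~R) -intrD floor_le_tmp floorD1_gt.
Qed.

Lemma frac_id x : 0 <= x < 1 -> frac x = x.
Proof.
move=> x01; rewrite /frac (@floor_def _ _ 0) ?subr0//.
Qed.

Lemma fracD1 x : frac (x + 1) = frac x.
Proof. by rewrite /frac floorDrz ?intr1// floor1 intrD; ring. Qed.

Lemma measurable_frac : measurable_fun setT frac.
Proof.
apply: measurable_funB => //; apply: nondecreasing_measurable => // x y xy.
by rewrite ler_int le_floor.
Qed.

Lemma periodic_frac V (f : R -> V) : (forall x, f (x + 1) = f x) ->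
  forall x, f x = f (frac x).
Proof.
move=> per x.
have pern (k : nat) y : f (y + k%:R) = f y.
  by elim: k => [|k IH]; rewrite ?addr0// -natr1 addrA per.
rewrite /frac; case: (Num.floor x) => k.
  by rewrite -[in LHS](subrK (k%:R) x) pern.
by rewrite NegzE mulrNz opprK pern.
Qed.

Lemma periodic_measurable (f : R -> R) : (forall x, f (x + 1) = f x) ->
  measurable_fun (`[0, 1] : set R) f -> measurable_fun setT f.
Proof.
move=> per mf; have -> : f = (f \_ `[0, 1]) \o frac.
  apply/funext => x; rewrite (periodic_frac per) /= patchE ifT// inE/= in_itv/=.
  by have := frac_itv x; lra.
apply: measurableT_comp measurable_frac.
exact/(measurable_restrictT _ _).1.
Qed.

End periodic_extension.

Lemma ae_filter_lebesgue (R : realType) :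
  Filter (almost_everywhere (@lebesgue_measure R)).
Proof. exact: ae_filter_ringOfSetsType. Qed.

(* The library's own hint fails to infer the measurable structure on R. *)
#[local] Hint Extern 0 (Filter (nbhs (almost_everywhere lebesgue_measure))) =>
  exact: ae_filter_lebesgue : typeclass_instances.

Lemma muleVK (R : realType) (a : R) (x : \bar R) : a != 0 ->
  (a%:E * ((a^-1)%:E * x) = x)%E.
Proof. by move=> a0; rewrite muleA -EFinM mulfV// mul1e. Qed.

Lemma ge0_integralZl_itv (R : realType) (a b k : R) (f : R -> \bar R) : 0 <= k ->
  measurable_fun setT f -> (forall x, 0 <= f x)%E ->
  (k%:E * \int[lebesgue_measure]_(x in `[a, b]) f x =
   \int[lebesgue_measure]_(x in `[a, b]) (k%:E * f x))%E.
Proof.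
move=> k0 mf f0; rewrite ge0_integralZl//; exact: measurable_funTS.
Qed.

Section regular_closed_curve.
Variables (R : realType) (n : nat) (gamma g : R -> 'rV[R]_n) (c : R).
Notation mu := (@lebesgue_measure R).
Hypotheses (gamma1 : periodic gamma 1) (g1 : periodic g 1).
Hypotheses (gammaL1 : circle_L1 gamma) (gL1 : circle_L1 g).
Hypothesis weak : forall (phi : R -> R) (i : 'I_n), periodic phi 1 -> smooth phi ->
  \int[mu]_(x in `[0, 1]) (gamma x 0 i * derive1 phi x) =
  - \int[mu]_(x in `[0, 1]) (g x 0 i * phi x).
Hypotheses (c0 : 0 < c) (gc : {ae mu, forall x : R, c <= enorm (g x)}).

Let circle_measurable (f : R -> 'rV[R]_n) : periodic f 1 -> circle_L1 f -> measurable_vec f.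
Proof.
move=> f1 fL1 i; apply: periodic_measurable => [x|]; first by rewrite f1.
by apply/measurable_EFinP; exact: measurable_int (fL1 i).
Qed.

Let mgamma : measurable_vec gamma. Proof. exact: circle_measurable. Qed.
Let mg : measurable_vec g. Proof. exact: circle_measurable. Qed.

Let l x := enorm (g x).

Let l0 x : 0 <= l x. Proof. exact: enorm_ge0. Qed.

Let ml : measurable_fun setT l. Proof. exact: measurable_enorm. Qed.

Let li : mu.-integrable `[0, 1] (EFin \o l).
Proof.
have iS : mu.-integrable `[0, 1] (EFin \o (fun x => \sum_i `|g x 0 i|)).
  rewrite (_ : _ \o _ = fun x => (\sum_i `|(g x 0 i)%:E|)%E); last first.
    by apply/funext => x; rewrite /= -sumEFin.
  by apply: integrable_sum => // i _; exact: integrable_abse (gL1 i).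
apply: le_integrable iS => //.
  by apply/measurable_EFinP; exact: measurable_funTS.
move=> x _; rewrite /= lee_fin ger0_norm// ger0_norm ?sumr_ge0//.
exact: enorm_sum_le.
Qed.

Let L := \int[mu]_(x in `[0, 1]) l x.

Let L0 : 0 < L.
Proof.
apply: lt_le_trans (speed_integral_ge l0 li c0 gc ml (lexx 0) ler01 (lexx 1)).
by rewrite subr0 mulr1.
Qed.

Let rho := arclength_inverse l0 li c0 gc ml.
Let tau x := normalize (g x).
Let mtau : measurable_vec tau. Proof. exact: measurable_normalize. Qed.

Let weak_primitive i : \int[mu]_(x in `[0, 1]) g x 0 i = 0 /\
  exists C, {ae mu, forall x, 0 <= x <= 1 ->
    gamma x 0 i = C + \int[mu]_(z in `[0, x]) g z 0 i}.
Proof.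
apply: du_bois_reymond.
- exact: mgamma.
- exact: mg.
- exact: gammaL1.
- exact: gL1.
- by move=> phi tphi; apply: weak; [exact: trig_periodic|exact: trig_smooth].
Qed.

Let C i := projT1 (cid (weak_primitive i).2).

Let prim i := (fun x => \int[mu]_(z in `[0, x]) g z 0 i) \_ `[0, 1].

(** The representative of [gamma] that is continuous on [0, 1] and satisfies the increment formula
    at every pair of points; [gamma] itself agrees with it only almost everywhere. *)
Let G x : 'rV[R]_n := \row_i (C i + prim i x).

Let primE i x : 0 <= x <= 1 -> prim i x = \int[mu]_(z in `[0, x]) g z 0 i.
Proof. by move=> x01; rewrite /prim patchE ifT// inE/= in_itv. Qed.

Let mG : measurable_vec G.
Proof.
move=> i; rewrite (_ : (fun x => G x 0 i) = (fun x => C i + prim i x)); last first.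
  by apply/funext => x; rewrite mxE.
apply: measurable_funD => //; apply/(measurable_restrictT _ _).1 => //.
apply: subspace_continuous_measurable_fun => //.
exact: (parameterized_integral_continuous ler01 (gL1 i)).
Qed.

Let GB i x y : 0 <= x -> x <= y -> y <= 1 ->
  G y 0 i - G x 0 i = \int[mu]_(z in `[x, y]) g z 0 i.
Proof.
move=> x0 xy y1; rewrite !mxE !primE ?x0 ?y1 ?(le_trans x0)// ?(le_trans xy)//.
rewrite (Rintegral_itvD x0 xy); first by ring.
exact: integrable_sub_itv (gL1 i).
Qed.

Let G1 : G 1 = G 0.
Proof.
apply/rowP => i; apply/eqP; rewrite -subr_eq0 GB ?ler01// ?lexx//.
by rewrite (weak_primitive i).1.
Qed.

Let gamma_ae : {ae mu, forall x, 0 <= x <= 1 -> gamma x = G x}.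
Proof.
have h i : {ae mu, forall x, 0 <= x <= 1 -> gamma x 0 i = G x 0 i}.
  have := projT2 (cid (weak_primitive i).2); rewrite -/(C i).
  apply: filterS => x /= xe x01; rewrite mxE primE//; exact: xe.
have : {ae mu, forall x, forall i : 'I_n, 0 <= x <= 1 -> gamma x 0 i = G x 0 i}.
  exact: filter_forall.
by apply: filterS => x xe x01; apply/rowP => i; exact: xe.
Qed.

(** The parameter interval has length 1 and the curve length [L], so the constant speed is [L].
    Composition with [frac] makes curve and tangent periodic on the line. *)
Let T u := L *: tau (rho (frac u)).
Let Gam u := G (rho (frac u)).

Let frac1 : frac (1 : R) = 0.
Proof. by rewrite -[X in frac X]add0r fracD1 frac_id// lexx ltr01. Qed.

Let tau1 : tau 1 = tau 0.
Proof. by rewrite /tau -[X in g X]add0r g1. Qed.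

(** Only u = 1 needs care: there [frac] returns 0, and periodicity of [g] identifies the two
    tangents. *)
Let TE u : 0 <= u <= 1 -> T u = L *: tau (rho u).
Proof.
move=> /andP[u0]; rewrite le_eqVlt => /predU1P[->|u1].
  by rewrite /T frac1 /rho arclength_inverse0 arclength_inverse1 tau1.
by rewrite /T frac_id// u0.
Qed.

Let GamE u : 0 <= u <= 1 -> Gam u = G (rho u).
Proof.
move=> /andP[u0]; rewrite le_eqVlt => /predU1P[->|u1].
  by rewrite /Gam frac1 /rho arclength_inverse0 arclength_inverse1 G1.
by rewrite /Gam frac_id// u0.
Qed.

Let rho_itv u : 0 <= rho u <= 1. Proof. exact: arclength_inverse_itv. Qed.

Let mrho : measurable_fun setT rho. Proof. exact: measurable_arclength_inverse. Qed.

Let mrhofrac : measurable_fun setT (fun u => rho (frac u)).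
Proof. exact: (measurableT_comp mrho (@measurable_frac R)). Qed.

Let mT : measurable_vec T.
Proof.
apply: measurable_vecZ => //.
exact: (measurable_vec_comp mrhofrac mtau).
Qed.

Let mGam : measurable_vec Gam.
Proof. exact: (measurable_vec_comp mrhofrac mG). Qed.

Let TL u : enorm (T u) <= L.
Proof.
by rewrite enormZ gtr0_norm// ler_piMr ?(ltW L0)// enorm_normalize_le1.
Qed.

Let tau_l i x : tau x 0 i * l x = g x 0 i.
Proof.
rewrite /tau /normalize mxE /l; have [->|gx] := eqVneq (g x) 0.
  by rewrite mxE mulr0 mul0r.
by rewrite mulrAC mulVf ?mul1r// enorm_eq0.
Qed.

Let Gam_incr x y i : 0 <= x -> x <= y -> y <= 1 ->
  Gam y 0 i - Gam x 0 i = \int[mu]_(z in `[x, y]) T z 0 i.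
Proof.
move=> x0 xy y1.
have x01 : 0 <= x <= 1 by rewrite x0 (le_trans xy).
have y01 : 0 <= y <= 1 by rewrite y1 (le_trans x0).
rewrite !GamE// GB; last 3 first.
- by case/andP: (rho_itv x).
- by rewrite /rho arclength_inverse_mono.
- by case/andP: (rho_itv y).
have tb z : `|tau z 0 i| <= 1.
  exact: le_trans (le_coord_enorm _ _) (enorm_normalize_le1 _).
have -> : \int[mu]_(z in `[x, y]) T z 0 i =
    \int[mu]_(z in `[x, y]) (L * tau (rho z) 0 i).
  apply: eq_Rintegral => z; rewrite inE/= in_itv/= => zxy.
  by rewrite TE ?mxE//; lra.
rewrite RintegralZl//; last first.
  apply: (bounded_integrable_itv (K := 1)) => //.
  exact: (measurableT_comp (mtau i) mrho).
rewrite (@Rintegral_arclength _ _ _ l0 li c0 gc ml (fun z => tau z 0 i) 1)//.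
rewrite mulrA mulfV ?mul1r ?gt_eqF//.
by under [RHS]eq_Rintegral do rewrite tau_l.
Qed.

(** Since [rho] maps onto [0, 1], a constant [Gam] would make [G] constant and [g] zero almost
    everywhere there, against the lower bound on the speed. *)
Let Gam_nonconstant : exists2 a, 0 <= a <= 1 & Gam a != Gam 0.
Proof.
apply: contrapT => cst.
have Gcst x : 0 <= x <= 1 -> G x = G 0.
  move=> x01; have [u u01 ux] := arclength_inverse_surj l0 li c0 gc ml x01.
  have z01 : 0 <= (0 : R) <= 1 by rewrite lexx ler01.
  have : Gam u = Gam 0.
    by apply/eqP; apply: contrapT => /negP ne; apply: cst; exists u.
  by rewrite (GamE u01) (GamE z01) /rho ux arclength_inverse0.
have gi i : {ae mu, forall x, 0 < x < 1 -> g x 0 i = 0}.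
  apply: (@primitive_cst_ae0 R (fun x => g x 0 i) 0) => [|x x01]; first exact: gL1.
  by rewrite -GB ?Gcst ?subrr//; lra.
have g0 : {ae mu, forall x, forall i : 'I_n, 0 < x < 1 -> g x 0 i = 0}.
  exact: filter_forall.
have : {ae mu, forall x : R, ~ (0 < x < 1)}.
  apply: filterS2 g0 gc => x gx0 gxc x01.
  have gx : g x = 0 by apply/rowP => i; rewrite mxE; exact: gx0.
  by move: gxc; rewrite gx enorm0 leNgt c0.
move=> [N [mN N0 sN]].
have : (mu (`]0%R, 1%R[%classic : set (measurableTypeR R)) <= mu N)%E.
  apply: le_measure; rewrite ?inE// => x /=; rewrite in_itv/= => x01.
  by apply: sN => /=; exact.
by rewrite N0 lebesgue_measure_itv/= lte01 -EFinB subr0 lee_fin leNgt ltr01.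
Qed.

Let P := (measurableTypeR R * measurableTypeR R)%type.

Let dens (f : R -> 'rV[R]_n) (z : P) : R :=
  enorm (tau z.1 - tau z.2) ^+ 2 / (2 * enorm (f z.1 - f z.2) ^+ 2).

Let dens_ge0 f z : 0 <= dens f z.
Proof. by rewrite /dens divr_ge0 ?sqr_ge0// mulr_ge0// sqr_ge0. Qed.

Let measurable_diff (f : R -> 'rV[R]_n) : measurable_vec f ->
  measurable_fun setT (fun z : P => enorm (f z.1 - f z.2) ^+ 2).
Proof.
move=> mf; apply: measurable_funX; apply: measurable_enorm; apply: measurable_vecB.
  exact: (measurable_vec_comp measurable_fst).
exact: (measurable_vec_comp measurable_snd).
Qed.

Let measurable_dens (f : R -> 'rV[R]_n) : measurable_vec f ->
  measurable_fun setT (dens f).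
Proof.
move=> mf; apply: measurable_funM; first exact: measurable_diff.
apply: (measurableT_comp (@measurable_inv R)).
by apply: measurable_funM => //; exact: measurable_diff.
Qed.

Let wdens f (z : P) : \bar R := (dens f z * l z.1 * l z.2)%:E.

Let wdens_ge0 f z : (0 <= wdens f z)%E.
Proof. by rewrite lee_fin; apply: mulr_ge0 => //; apply: mulr_ge0. Qed.

Let measurable_wdens (f : R -> 'rV[R]_n) : measurable_vec f ->
  measurable_fun setT (wdens f).
Proof.
move=> mf; apply/measurable_EFinP; apply: measurable_funM.
  apply: measurable_funM; first exact: measurable_dens.
  exact: (measurableT_comp ml measurable_fst).
exact: (measurableT_comp ml measurable_snd).
Qed.

Let energy_continuous_representative :
  (\int[mu]_(x in `[0%R, 1%R]) \int[mu]_(y in `[0%R, 1%R]) wdens gamma (x, y) =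
   \int[mu]_(x in `[0%R, 1%R]) \int[mu]_(y in `[0%R, 1%R]) wdens G (x, y))%E.
Proof.
have sec (f : R -> 'rV[R]_n) (x : R) : measurable_vec f ->
    measurable_fun (`[0, 1] : set R) (fun y => wdens f (x, y)).
  move=> mf; apply: measurable_funTS.
  exact: (measurableT_comp (measurable_wdens mf) (pair1_measurable (x : measurableTypeR R))).
apply: ge0_ae_eq_integral => //.
- apply: measurable_funTS.
  exact: (measurable_integral_itv 0 1 (measurable_wdens mgamma) (wdens_ge0 gamma)).
- apply: measurable_funTS.
  exact: (measurable_integral_itv 0 1 (measurable_wdens mG) (wdens_ge0 G)).
- by move=> x _; exact: integral_ge0.
- by move=> x _; exact: integral_ge0.
apply: filterS gamma_ae => x /= xe x01.
apply: ge0_ae_eq_integral => //; [exact: sec|exact: sec|].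
apply: filterS gamma_ae => y /= ye y01.
by move: x01 y01; rewrite /= !in_itv/= => x01 y01; rewrite /wdens /dens/= xe// ye.
Qed.

Let L_neq0 : L != 0.
Proof. exact: lt0r_neq0 L0. Qed.

(** Each variable is substituted by l(x) dx = L du, which contributes a factor [L] and absorbs the
    speed weight; the inner variable is treated first. *)
Let energy_arclength :
  (\int[mu]_(x in `[0%R, 1%R]) \int[mu]_(y in `[0%R, 1%R]) wdens G (x, y) =
   \int[mu]_(u in `[0%R, 1%R]) \int[mu]_(v in `[0%R, 1%R])
     (L ^+ 2 * dens G (rho u, rho v))%:E)%E.
Proof.
pose h (z : P) : \bar R := (dens G (z.1, rho z.2))%:E.
have mh : measurable_fun setT h.
  apply/measurable_EFinP; apply: (measurableT_comp (measurable_dens mG)).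
  apply: measurable_fun_pair; first exact: measurable_fst.
  exact: (measurableT_comp mrho measurable_snd).
have h0 z : (0 <= h z)%E by rewrite lee_fin dens_ge0.
have mlE : measurable_fun setT (fun x => (l x)%:E) by exact/measurable_EFinP.
have lE0 x : (0 <= (l x)%:E)%E by rewrite lee_fin; exact: l0.
have inner x : (\int[mu]_(y in `[0%R, 1%R]) wdens G (x, y) =
    (L * l x)%:E * \int[mu]_(v in `[0%R, 1%R]) h (x, v))%E.
  have mk : measurable_fun setT (fun y => (dens G (x, y))%:E).
    apply/measurable_EFinP; apply: (measurableT_comp (measurable_dens mG)).
    exact: (pair1_measurable (x : measurableTypeR R)).
  have k0 y : (0 <= (dens G (x, y))%:E)%E by rewrite lee_fin dens_ge0.
  have mkl : measurable_fun setT (fun y => (dens G (x, y))%:E * (l y)%:E)%E.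
    exact: emeasurable_funM mk mlE.
  have kl0 y : (0 <= (dens G (x, y))%:E * (l y)%:E)%E.
    exact: mule_ge0 (k0 y) (lE0 y).
  rewrite /h /= (ge0_integral_arclength l0 li c0 gc ml mk k0) mulrC EFinM.
  rewrite -muleA (muleVK _ L_neq0) (ge0_integralZl_itv 0 1 (l0 x) mkl kl0).
  by apply: eq_integral => y _; rewrite /wdens /= -!EFinM mulrA [l x * _]mulrC.
pose H x := (\int[mu]_(v in `[0%R, 1%R]) h (x, v))%E.
have mH : measurable_fun setT H by exact: measurable_integral_itv.
have H0 x : (0 <= H x)%E by apply: integral_ge0 => v _; exact: h0.
have L_ge0 : 0 <= L by exact: ltW L0.
have mHl : measurable_fun setT (fun x => H x * (l x)%:E)%E.
  exact: emeasurable_funM mH mlE.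
have Hl0 x : (0 <= H x * (l x)%:E)%E by exact: mule_ge0 (H0 x) (lE0 x).
transitivity (L%:E * \int[mu]_(x in `[0%R, 1%R]) (H x * (l x)%:E))%E.
  rewrite (ge0_integralZl_itv 0 1 L_ge0 mHl Hl0).
  by apply: eq_integral => x _; rewrite inner -/(H x) EFinM -muleA [((l x)%:E * _)%E]muleC.
have e := ge0_integral_arclength l0 li c0 gc ml mH H0.
have -> : (\int[mu]_(x in `[0%R, 1%R]) (H x * (l x)%:E) =
    L%:E * \int[mu]_(u in `[0%R, 1%R]) H (rho u))%E by rewrite e (muleVK _ L_neq0).
have mHr : measurable_fun setT (fun u => H (rho u)) by exact: (measurableT_comp mH mrho).
rewrite muleA -EFinM -expr2 (ge0_integralZl_itv 0 1 (sqr_ge0 L) mHr (fun u => H0 (rho u))).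
apply: eq_integral => u _.
have mhu : measurable_fun setT (fun v => h (rho u, v)).
  exact: (measurableT_comp mh (pair1_measurable (rho u : measurableTypeR R))).
rewrite /H (ge0_integralZl_itv 0 1 (sqr_ge0 L) mhu (fun v => h0 (rho u, v))).
by apply: eq_integral => v _; rewrite /h -EFinM.
Qed.

Lemma regular_closed_curve_energy_ge : ((2 * pi ^+ 2)%:E <=
  \int[mu \x mu]_(z in `[0%R, 1%R] `*` `[0%R, 1%R])
    (enorm (normalize (g z.1) - normalize (g z.2)) ^+ 2
     / (2 * enorm (gamma z.1 - gamma z.2) ^+ 2)
     * enorm (g z.1) * enorm (g z.2))%:E)%E.
Proof.
rewrite (tonelli_itv 0 1 0 1 (measurable_wdens mgamma) (wdens_ge0 gamma)).1.
rewrite energy_continuous_representative energy_arclength.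
have Gam1 x : Gam (x + 1) = Gam x by rewrite /Gam fracD1.
have T1 x : T (x + 1) = T x by rewrite /T fracD1.
have := closed_curve_energy_ge mGam mT Gam1 T1 TL Gam_incr Gam_nonconstant.
pose k (z : P) : \bar R := (enorm (T z.1 - T z.2) ^+ 2 / enorm (Gam z.1 - Gam z.2) ^+ 2)%:E.
have mk : measurable_fun setT k.
  apply/measurable_EFinP; apply: measurable_funM; first exact: measurable_diff.
  by apply: (measurableT_comp (@measurable_inv R)); exact: measurable_diff.
have k0 z : (0 <= k z)%E by rewrite lee_fin; exact: divr_ge0 (sqr_ge0 _) (sqr_ge0 _).
rewrite -(tonelli_itv 0 1 0 1 mk k0).2 => E4.
have half_ge0 : 0 <= 2^-1 :> R by rewrite invr_ge0 ler0n.
have half4 : (2 * pi ^+ 2 : R)%:E = ((2^-1)%:E * (4 * pi ^+ 2)%:E)%E.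
  by rewrite -EFinM; congr EFin; move: (pi ^+ 2) => p; lra.
have mK : measurable_fun setT (fun u => \int[mu]_(v in `[0%R, 1%R]) k (u, v))%E.
  exact: measurable_integral_itv.
have K0 u : (0 <= \int[mu]_(v in `[0%R, 1%R]) k (u, v))%E.
  by apply: integral_ge0 => v _; exact: k0.
rewrite half4; apply: (@le_trans _ _ ((2^-1)%:E *
    \int[mu]_(x in `[0%R, 1%R]) \int[mu]_(y in `[0%R, 1%R]) k (x, y))%E).
  by apply: lee_wpmul2l => //; rewrite lee_fin.
rewrite (ge0_integralZl_itv 0 1 half_ge0 mK K0).
rewrite le_eqVlt; apply/orP; left; apply/eqP; apply: eq_integral => u.
rewrite inE/= in_itv/= => u01.
have mku : measurable_fun setT (fun v => k (u, v)).
  exact: (measurableT_comp mk (pair1_measurable (u : measurableTypeR R))).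
rewrite (ge0_integralZl_itv 0 1 half_ge0 mku (fun v => k0 (u, v))).
apply: eq_integral => v; rewrite inE/= in_itv/= => v01.
rewrite /k /= -EFinM; congr EFin.
rewrite (TE u01) (TE v01) (GamE u01) (GamE v01) /dens/= -scalerBr enormZ.
(* The factor L^2 of the substitution is the one in |T u - T v|^2, and the 2 in the denominator of
   the energy is the factor 1/2 between 4 pi^2 and 2 pi^2. *)
have scaling (s a b : R) :
    2^-1 * ((s * a) ^+ 2 / b ^+ 2) = s ^+ 2 * (a ^+ 2 / (2 * b ^+ 2)).
  by rewrite exprMn (invfM 2); ring.
by rewrite (gtr0_norm L0); exact: scaling.
Qed.

End regular_closed_curve.

Theorem theorem3p4 (R : realType) (gamma : R -> 'rV[R]_3)
  (gamma_closed : periodic gamma 1)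
  (gamma_sobolev : sobolev_3half_2 gamma)
  (gamma_regular : regular_curve gamma) :
  ((2 * pi ^+ 2)%:E <= energy1 gamma)%E.
Proof.
have [[_ ex _] _] := gamma_sobolev; have [c c0 gc] := gamma_regular.
(* Existence of a weak derivative excludes the default value of [weak_deriv]. *)
have [g1 gammaL1 gL1 weak] : is_weak_deriv gamma (weak_deriv gamma).
  by have [g wg] := ex; apply: (xgetPex (fun=> 0) (P := [set g | is_weak_deriv gamma g]));
    exists g.
exact: (regular_closed_curve_energy_ge gamma_closed g1 gammaL1 gL1 weak c0 gc).
Qed.
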